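(* Let $\{a_n,b_n\}_{n=1}^\infty$ be Jacobi parameters with $$\lim_{n\to\infty}a_n=1,\qquad \lim_{n\to\infty}b_n=0,\qquad \sum_{n=1}^\infty\bigl(|a_{n+1}-a_n|+|b_{n+1}-b_n|\bigr)<\infty .$$ Then for every $\varepsilon>0$ there is uniform clock behavior on the interval $[-2+\varepsilon,2-\varepsilon]$.
   Context: Jacobi parameters are bounded sequences $a_n>0$, $b_n\in\mathbb{R}$ ($n\ge 1$). The associated orthonormal polynomials $p_n$ are defined by $p_{-1}=0$, $p_0=1$ and $xp_n(x)=a_{n+1}p_{n+1}(x)+b_{n+1}p_n(x)+a_np_{n-1}(x)$, $n\ge 0$. The zeros of $p_n$ are real and simple; let $\nu_n$ be the probability measure giving weight $1/n$ to each of the $n$ zeros of $p_n$. The density of states exists if $\nu_n$ has a weak limit $\nu$ as $n\to\infty$. (When $a_n\to1$, $b_n\to0$ it is known that it exists and $d\nu=\pi^{-1}(4-x^2)^{-1/2}\chi_{[-2,2]}(x)\,dx$.) There is uniform clock behavior on $[\alpha,\beta]$ if $d\nu/dE$ is continuous and nonvanishing on $[\alpha,\beta]$ and $$\lim_{n\to\infty}\ \sup\Bigl\{\Bigl|\,n|E-E'|-\Bigl(\frac{d\nu}{dE}(E)\Bigr)^{-1}\Bigr| \ :\ E,E'\text{ are successive zeros of }p_n\text{ in }[\alpha,\beta]\Bigr\}=0 .$$ *)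

(* Defs.v *)
From HB Require Import structures.
From mathcomp Require Import all_boot all_order all_algebra.
From mathcomp Require Import polyrcf.
From mathcomp Require Import all_classical all_reals all_analysis.
Set Implicit Arguments.
Unset Strict Implicit.
Unset Printing Implicit Defensive.
Import Order.TTheory GRing.Theory Num.Theory.
Import numFieldNormedType.Exports.
Local Open Scope classical_set_scope.
Local Open Scope ring_scope.

(* Sequences (a_n), (b_n) indexed by n >= 1 are functions on nat whose value
   at 0 is never relevant. *)
Definition jacobi_parameters (R : realType) (a b : nat -> R) : Prop :=
  (forall n : nat, (0 < n)%N -> 0 < a n) /\
  (exists M : R, forall n : nat, (0 < n)%N -> `|a n| <= M /\ `|b n| <= M).

(* The three-term recurrence, solved for the polynomial of highest index;
   the inner match is p_(m-1), with p_(-1) = 0. *)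
Fixpoint orthonormal_poly (R : realType) (a b : nat -> R) (n : nat) : {poly R} :=
  match n with
  | 0 => 1
  | m.+1 =>
      (a m.+1)^-1 *: (('X - (b m.+1)%:P) * orthonormal_poly a b m
        - a m *: match m with 0 => 0 | k.+1 => orthonormal_poly a b k end)
  end.

Lemma orthonormal_poly_rec (R : realType) (a b : nat -> R) (n : nat) :
  jacobi_parameters a b ->
  'X * orthonormal_poly a b n
  = a n.+1 *: orthonormal_poly a b n.+1 + b n.+1 *: orthonormal_poly a b n
    + a n *: (if n is k.+1 then orthonormal_poly a b k else 0).
Proof.
case=> /(_ n.+1 isT) a_gt0 _.
rewrite [orthonormal_poly a b n.+1]/= scalerA divff ?gt_eqF// scale1r.
by rewrite mulrBl mul_polyC addrAC subrK subrK.
Qed.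

(* rootsR p lists the distinct real roots of p (for p <> 0). *)
Definition zero_measure (R : realType) (a b : nat -> R) (n : nat) :
    {measure set (measurableTypeR R) -> \bar R} :=
  let zs := rootsR (orthonormal_poly a b n) in
  mscale (n%:R^-1)%:nng
    (msum (fun k : nat => \d_(zs`_k : measurableTypeR R)) (size zs)).

Definition weakly_converges (R : realType)
    (mu : nat -> {measure set (measurableTypeR R) -> \bar R})
    (nu : {measure set (measurableTypeR R) -> \bar R}) : Prop :=
  forall f : R -> R, continuous f -> bounded_fun f ->
    (\int[mu n]_x (f x)%:E)%E @[n --> \oo] --> (\int[nu]_x (f x)%:E)%E.

Definition is_density_of_states (R : realType) (a b : nat -> R)
    (nu : probability (measurableTypeR R) R) : Prop :=
  weakly_converges (zero_measure a b) nu.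

(* On [alpha, beta], nu is absolutely continuous with dnu/dE = rho. *)
Definition is_density_on (R : realType)
    (nu : {measure set (measurableTypeR R) -> \bar R}) (alpha beta : R)
    (rho : R -> R) : Prop :=
  forall A : set (measurableTypeR R), measurable A -> A `<=` `[alpha, beta] ->
    nu A = (\int[lebesgue_measure]_(x in A) (rho x)%:E)%E.

Definition successive_zeros (R : realType) (p : {poly R}) (alpha beta : R)
    (E E' : R) : Prop :=
  [/\ E \in `[alpha, beta], E' \in `[alpha, beta], root p E, root p E' &
      E != E' /\
      forall z : R, root p z -> ~~ (Num.min E E' < z < Num.max E E')].

Definition clock_deviations (R : realType) (a b : nat -> R) (rho : R -> R)
    (alpha beta : R) (n : nat) : set R :=
  [set d : R | exists E E' : R,
     successive_zeros (orthonormal_poly a b n) alpha beta E E' /\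
     d = `| n%:R * `|E - E'| - (rho E)^-1 | ].

(* The set of deviations is finite, and sup set0 = 0, so the real-valued sup
   is the supremum of nonnegative numbers meant here. *)
Definition uniform_clock_behavior (R : realType) (a b : nat -> R)
    (alpha beta : R) : Prop :=
  exists (nu : probability (measurableTypeR R) R) (rho : R -> R),
    [/\ is_density_of_states a b nu,
        is_density_on nu alpha beta rho,
        {within `[alpha, beta], continuous rho},
        (forall x : R, x \in `[alpha, beta] -> rho x != 0) &
        sup (clock_deviations a b rho alpha beta n) @[n --> \oo] --> (0 : R)].

(* Main.v *)
Require Import Defs.
From HB Require Import structures.
From mathcomp Require Import all_boot all_order all_algebra.
From mathcomp Require Import complex polyrcf ring lra.
From mathcomp Require Import all_classical all_reals all_analysis.
From mathcomp Require Import measurable_realfun.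
Set Implicit Arguments.
Unset Strict Implicit.
Unset Printing Implicit Defensive.
Import Order.TTheory GRing.Theory Num.Theory.
Import numFieldNormedType.Exports.
Local Open Scope classical_set_scope.
Local Open Scope ring_scope.
Local Open Scope complex_scope.

(** Write [x = 2 * cos t] with [t] in [0, pi]. In the free case [a = 1], [b = 0] one has
    [p_n (2 * cos t) = sin ((n + 1) * t) / sin t], whose zeros are equally spaced in [t].
    The theorem holds because, at scale [1 / n], coefficients of bounded variation leave
    this picture intact.

    The tool is the complex number [z_n = circ c_n * p_n - p_(n-1)] ([jost]), where
    [c_n = (x - b_n) / (2 * a_n)] is the cosine of a local angle and [circ c] is the unit
    number with real part [c] in the upper half plane. Its imaginary part is a positive
    multiple of [p_n], and one step of the recurrence multiplies it by [circ c_(n+1)] up to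
    a relative error of the order of [|a_(n+1) - a_n| + |b_(n+1) - b_n|]
    ([jost_step_err]), which is summable.

    The accumulated angle of [z_n] need not be close to [n * t], but only differences of
    angles matter. For two energies [2 * cos t] and [2 * cos t'] at a distance of order
    [1 / n], the product [z_j (t') * conj z_j (t)] turns at step [j] by [t' - t] up to an
    error that is small compared with [1 / n], plus the summable one. Fixing [N] so large
    that everything past [N] is small, and using that [z_N] is continuous and never zero,
    one gets [z_n (t') * conj z_n (t) = A * (exp (i * n * (t' - t)) + o(1))] with [A > 0],
    uniformly away from the band edges ([jost_prod_rotation]). Neither a limit of [z_n] nor
    a continuous choice of its argument enters.

    Two facts follow. A half turn reverses the sign of [p_n], so every window of angular
    length slightly more than [pi / n] contains a zero ([root_in_window]). At successive
    zeros [z_n = - p_(n-1)] is real, and the Wronskian of [p_n] and [p_(n-1)] shows that it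
    has opposite signs there; so [n * (t' - t)] is near an odd multiple of [pi], and by the
    first fact near [pi] itself ([successive_roots_angle]). Passing from angles to energies
    multiplies the spacing by [2 * sin t], and [2 * pi * sin t] is the reciprocal of the
    arcsine density ([clock_spacing]).

    The density of states comes from the same windows. Each has arcsine mass about [1 / n]
    and contains a zero, so the zeros asymptotically give a nonnegative test function at
    least its arcsine integral; their total mass is at most 1 because [p_n] has degree at
    most [n], and the arcsine law has mass 1. Applied to [M + f] and [M - f], this gives
    weak convergence ([arcsine_density_of_states]). *)

(** * The unit semicircle, parametrized by its abscissa *)

Section Modulus.
Variable R : realType.
Implicit Types (z w : R[i]) (c d eta al t x y : R).

(** The norm of [R[i]] takes its values in [R[i]]; real inequalities need it in [R]. *)
Definition cmod z : R := Normc.normc z.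

Lemma cmodM z w : cmod (z * w) = cmod z * cmod w.
Proof. exact: Normc.normcM. Qed.

Lemma cmod_le_add z w : cmod (z + w) <= cmod z + cmod w.
Proof. exact: (@le_normcD R z w). Qed.

Lemma cmodN z : cmod (- z) = cmod z.
Proof. exact: (@normcN R z). Qed.

Lemma cmod_le_sub z w : cmod (z - w) <= cmod z + cmod w.
Proof. by rewrite -[cmod w]cmodN cmod_le_add. Qed.

Lemma cmod_ge0 z : 0 <= cmod z.
Proof. by case: z => x y; exact: sqrtr_ge0. Qed.

Lemma cmodE (x y : R) : cmod (x +i* y) = Num.sqrt (x ^+ 2 + y ^+ 2).
Proof. by []. Qed.

Lemma cmod_sqr z : cmod z ^+ 2 = complex.Re z ^+ 2 + complex.Im z ^+ 2.
Proof. by case: z => x y; rewrite sqr_sqrtr// addr_ge0// sqr_ge0. Qed.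

Lemma cmod_real (x : R) : cmod x%:C = `|x|.
Proof. by rewrite cmodE expr0n addr0 sqrtr_sqr. Qed.

Lemma cmod0 : cmod 0 = 0.
Proof. by rewrite (cmod_real 0) normr0. Qed.

Lemma cmod1 : cmod 1 = 1.
Proof. by rewrite (cmod_real 1) normr1. Qed.

Lemma cmodJ z : cmod (z^*) = cmod z.
Proof. by case: z => x y; rewrite !cmodE sqrrN. Qed.

Lemma abs_Re_le z : `|complex.Re z| <= cmod z.
Proof.
case: z => x y; rewrite cmodE -sqrtr_sqr ler_wsqrtr//=.
by rewrite lerDl sqr_ge0.
Qed.

Lemma abs_Im_le z : `|complex.Im z| <= cmod z.
Proof.
case: z => x y; rewrite cmodE -sqrtr_sqr ler_wsqrtr//=.
by rewrite lerDr sqr_ge0.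
Qed.

Lemma mul_conj z : z * z^* = (cmod z ^+ 2)%:C.
Proof.
rewrite cmod_sqr; case: z => x y; apply/eqP; rewrite eq_complex/=.
by apply/andP; split; apply/eqP; ring.
Qed.

Definition sine c : R := Num.sqrt (1 - c ^+ 2).

(** For [c = cos t] with [t] in [0, pi] this is [exp (i * t)]. The recurrence provides
    the abscissa, and all that is used depends on it algebraically. *)
Definition circ c : R[i] := c +i* sine c.

Lemma sine_sqr c : `|c| <= 1 -> sine c ^+ 2 = 1 - c ^+ 2.
Proof.
move=> c1; rewrite sqr_sqrtr// subr_ge0.
by rewrite -[c ^+ 2]ger0_norm ?sqr_ge0// normrX exprn_ile1.
Qed.

Lemma cmod_circ c : `|c| <= 1 -> cmod (circ c) = 1.
Proof.
move=> c1; apply/eqP; rewrite -(@eqrXn2 _ 2)// ?cmod_ge0// cmod_sqr/=.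
by rewrite sine_sqr// addrC subrK expr1n.
Qed.

Lemma circ_sqr c : `|c| <= 1 -> circ c ^+ 2 = (2 * c)%:C * circ c - 1.
Proof.
move=> /sine_sqr; rewrite expr2 => h; apply/eqP; rewrite eq_complex/=.
by apply/andP; split; apply/eqP; rewrite ?h; ring.
Qed.

Lemma sine_ge0 c : 0 <= sine c. Proof. exact: sqrtr_ge0. Qed.

Lemma sine_ge c r : `|c| <= r -> sine r <= sine c.
Proof.
move=> cr; rewrite ler_wsqrtr// lerB// -[c ^+ 2]ger0_norm ?sqr_ge0// normrX.
by rewrite lerXn2r// ?nnegrE// (le_trans _ cr).
Qed.

Lemma sine_gt0 r : 0 <= r -> r < 1 -> 0 < sine r.
Proof. by move=> r0 r1; rewrite sqrtr_gt0 subr_gt0 expr_lt1. Qed.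

Lemma sine_le1 c : sine c <= 1.
Proof. by rewrite -[leRHS]sqrtr1 ler_wsqrtr// gerBl sqr_ge0. Qed.

Lemma sine_cos t : 0 <= t <= pi -> sine (cos t) = sin t.
Proof.
by move=> /sin_ge0_pi s0; rewrite /sine -sin2cos2 sqrtr_sqr ger0_norm.
Qed.

(** Minus the slope of the chord from [circ c] to [circ c'], in a form that remains
    meaningful for [c' = c]. *)
Definition slope c c' : R := (c + c') / (sine c + sine c').

Lemma sine_sub c c' : `|c| <= 1 -> `|c'| <= 1 -> 0 < sine c ->
  sine c' - sine c = - (c' - c) * slope c c'.
Proof.
move=> /sine_sqr h /sine_sqr h' s0; rewrite /slope.
have s1 : sine c + sine c' != 0 by rewrite gt_eqF// ltr_pwDl// sine_ge0.
apply: (mulIf s1); rewrite -!mulrA mulVf// mulr1; move: h h'; lra.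
Qed.

Lemma circ_sub c c' : `|c| <= 1 -> `|c'| <= 1 -> 0 < sine c ->
  circ c' - circ c = (c' - c)%:C * (1 -i* slope c c').
Proof.
move=> h h' s0; apply/eqP; rewrite eq_complex/= sine_sub//.
by apply/andP; split; apply/eqP; ring.
Qed.

Variables (r : R).
Hypotheses (r0 : 0 <= r) (r1 : r < 1).
Let s := sine r.
Let s0 : 0 < s. Proof. exact: sine_gt0. Qed.
Let L := 1 + s^-1.
Let le1 c : `|c| <= r -> `|c| <= 1. Proof. by move=> /le_trans; apply; exact: ltW. Qed.

Lemma abs_slope_le c c' : `|c| <= r -> `|c'| <= r -> `|slope c c'| <= s^-1.
Proof.
move=> h h'; rewrite normrM normfV [`|sine c + _|]ger0_norm ?addr_ge0 ?sine_ge0//.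
have sc := sine_ge h; have sc' := sine_ge h'.
have p : 0 < sine c + sine c' by rewrite ltr_pwDl ?sine_ge0// (lt_le_trans s0).
rewrite ler_pdivrMr// mulrC ler_pdivlMr//.
have : `|c + c'| <= 2.
  by rewrite (le_trans (ler_normD _ _))//; have := le1 h; have := le1 h'; lra.
have := s0; rewrite /s in sc sc' *; nra.
Qed.

Lemma cmod_chord_le c c' : `|c| <= r -> `|c'| <= r -> cmod (1 -i* slope c c') <= L.
Proof.
move=> h h'.
have -> : 1 -i* slope c c' = 1 + - ('i * (slope c c')%:C) :> R[i].
  by apply/eqP; rewrite eq_complex/=; apply/andP; split; apply/eqP; ring.
rewrite (le_trans (cmod_le_sub _ _))// cmod1 cmodM cmod_real lerD2l.
rewrite cmodE expr0n add0r expr1n sqrtr1 mul1r.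
exact: abs_slope_le.
Qed.

Lemma circ_lip c c' : `|c| <= r -> `|c'| <= r ->
  cmod (circ c' - circ c) <= L * `|c' - c|.
Proof.
move=> h h'; rewrite circ_sub ?le1 ?(lt_le_trans s0) ?sine_ge//.
by rewrite cmodM cmod_real mulrC ler_wpM2r// cmod_chord_le.
Qed.

Lemma sine_lip c c' : `|c| <= r -> `|c'| <= r ->
  `|sine c' - sine c| <= L * `|c' - c|.
Proof.
move=> h h'; have := circ_lip h h'; apply: le_trans.
by have := abs_Im_le (circ c' - circ c).
Qed.

Lemma slope_lip c c' d d' eta : `|c| <= r -> `|c'| <= r -> `|d| <= r -> `|d'| <= r ->
  `|d - c| <= eta -> `|d' - c'| <= eta ->
  `|slope d d' - slope c c'| <= (1 + L) / s ^+ 2 * eta.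
Proof.
move=> hc hc' hd hd' h h'.
have e0 : 0 <= eta by rewrite (le_trans _ h).
have sc := sine_ge hc; have sc' := sine_ge hc'.
have sd := sine_ge hd; have sd' := sine_ge hd'.
rewrite -/s in sc sc' sd sd'.
have pc : 0 < sine c + sine c' by have := s0; lra.
have pd : 0 < sine d + sine d' by have := s0; lra.
have -> : slope d d' - slope c c' =
   ((d + d' - (c + c')) * (sine c + sine c')
    - (c + c') * (sine d + sine d' - (sine c + sine c')))
   / ((sine c + sine c') * (sine d + sine d')).
  by rewrite /slope; field; rewrite !gt_eqF.
have L0 : 0 < L by rewrite /L ltr_wpDr ?invr_ge0 ?ltW.
have n1 : `|d + d' - (c + c')| <= 2 * eta.
  by move: h h'; rewrite !ler_norml; lra.
have n2 : `|sine d + sine d' - (sine c + sine c')| <= 2 * L * eta.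
  have := sine_lip hc hd; have := sine_lip hc' hd'.
  have : L * `|d' - c'| <= L * eta by rewrite ler_pM2l.
  have : L * `|d - c| <= L * eta by rewrite ler_pM2l.
  by rewrite !ler_norml; lra.
have n3 : `|c + c'| <= 2.
  by rewrite (le_trans (ler_normD _ _))//; have := le1 hc; have := le1 hc'; lra.
have n4 : `|sine c + sine c'| <= 2.
  by rewrite ger0_norm ?(ltW pc)//; have := sine_le1 c; have := sine_le1 c'; lra.
rewrite normrM normfV [`|(_ + _) * (_ + _)|]ger0_norm ?(mulr_ge0 (ltW pc) (ltW pd))//.
rewrite ler_pdivrMr ?mulr_gt0//.
have -> : (1 + L) / s ^+ 2 * eta * ((sine c + sine c') * (sine d + sine d')) =
   (1 + L) * eta * (((sine c + sine c') * (sine d + sine d')) / s ^+ 2).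
  by field; rewrite gt_eqF.
have n5 : 4 <= (sine c + sine c') * (sine d + sine d') / s ^+ 2.
  rewrite ler_pdivlMr ?exprn_gt0//.
  have -> : 4 * s ^+ 2 = (2 * s) * (2 * s) by ring.
  by rewrite ler_pM//; have := s0; clear - sc sc' sd sd'; lra.
apply: (@le_trans _ _ ((1 + L) * eta * 4)).
  rewrite (le_trans (ler_normB _ _))// !normrM.
  have : `|d + d' - (c + c')| * `|sine c + sine c'| <= (2 * eta) * 2 by rewrite ler_pM.
  have : `|c + c'| * `|sine d + sine d' - (sine c + sine c')| <= 2 * (2 * L * eta) by rewrite ler_pM.
  lra.
by rewrite ler_wpM2l// mulr_ge0// ltW// addr_gt0.
Qed.

(** Along short arcs away from [-1] and [1] the difference [circ c' / circ c - 1] is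
    [c' - c] times a Lipschitz function of the endpoints. So moving the endpoints by [eta],
    and scaling [c' - c] by a factor within [eta] of 1, changes the quotient by a multiple
    of [eta * |c' - c|] only: this is the gain that makes [n] such errors harmless. *)
Lemma circ_quotient_lip : {K : R | 0 < K & forall c c' d d' al eta,
  `|c| <= r -> `|c'| <= r -> `|d| <= r -> `|d'| <= r ->
  `|d - c| <= eta -> `|d' - c'| <= eta -> `|al - 1| <= eta -> `|al| <= 2 ->
  d' - d = al * (c' - c) ->
  cmod (circ d' * (circ d)^* - circ c' * (circ c)^*) <= K * eta * `|c' - c|}.
Proof.
have L0 : 0 < L by rewrite /L ltr_wpDr ?invr_ge0 ?ltW.
have Q0 : 0 < (1 + L) / s ^+ 2 by rewrite divr_gt0 ?exprn_gt0// addr_gt0.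
set Q := (1 + L) / s ^+ 2 in Q0 *.
exists (2 * Q + 2 * L * L + L); first by nra.
move=> c c' d d' al eta hc hc' hd hd' h h' hal al2 dd.
have e0 : 0 <= eta by rewrite (le_trans _ h).
have quot u u' : `|u| <= r -> `|u'| <= r ->
    circ u' * (circ u)^* = 1 + (u' - u)%:C * (1 -i* slope u u') * (circ u)^*.
  move=> hu hu'; rewrite -circ_sub ?le1 ?(lt_le_trans s0) ?sine_ge//.
  rewrite mulrBl mul_conj cmod_circ ?le1// expr1n.
  by rewrite addrC subrK.
rewrite !quot// dd.
set P := 1 -i* slope d d'; set P0 := 1 -i* slope c c'.
have -> : 1 + (al * (c' - c))%:C * P * (circ d)^* -
   (1 + (c' - c)%:C * P0 * (circ c)^*) =
   (c' - c)%:C * (al%:C * (P - P0) * (circ d)^* +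
     al%:C * P0 * (circ d - circ c)^* + (al - 1)%:C * P0 * (circ c)^*).
  by rewrite rmorphM !rmorphB /= rmorph1; ring.
rewrite cmodM cmod_real mulrC ler_wpM2r//.
rewrite (le_trans (cmod_le_add _ _))// mulrDl lerD//; last first.
  rewrite !cmodM cmod_real cmodJ cmod_circ ?le1// mulr1 mulrC ler_pM// ?cmod_ge0//.
  exact: cmod_chord_le.
rewrite (le_trans (cmod_le_add _ _))// mulrDl lerD//.
  rewrite !cmodM cmod_real cmodJ cmod_circ ?le1// mulr1 -mulrA ler_pM ?cmod_ge0//.
  have -> : P - P0 = - ('i * (slope d d' - slope c c')%:C).
    by apply/eqP; rewrite eq_complex/=; apply/andP; split; apply/eqP; ring.
  rewrite cmodN cmodM cmod_real cmodE expr0n add0r expr1n sqrtr1 mul1r.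
  exact: slope_lip.
rewrite !cmodM cmod_real cmodJ -!mulrA ler_pM ?mulr_ge0 ?cmod_ge0//.
rewrite ler_pM ?cmod_ge0// ?cmod_chord_le//.
by rewrite (le_trans (circ_lip hc hd))// ler_wpM2l// ltW.
Qed.

End Modulus.

(** * Sequences that nearly rotate *)

Section Gronwall.
Variable R : realType.

(** The constant 3 counts the two errors linear in [g] and the quadratic one, which
    [g <= 1] makes linear. *)
Lemma product_step (z w err err' e e' om : R[i]) (g h : R) :
  cmod e = 1 -> cmod e' = 1 -> cmod err <= g * cmod z -> cmod err' <= g * cmod w ->
  0 <= g <= 1 -> cmod (e' * e^* - om) <= h ->
  cmod (e' * (w + err') * (e * (z + err))^* - om * (w * z^*))
    <= (h + 3 * g) * cmod (w * z^*).
Proof.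
move=> e1 e1' he he' /andP[g0 g1] hh.
have -> : e' * (w + err') * (e * (z + err))^* - om * (w * z^*) =
  (e' * e^* - om) * (w * z^*) + e' * e^* * (err' * z^* + w * err^* + err' * err^*).
  by rewrite rmorphM rmorphD /=; ring.
rewrite (le_trans (cmod_le_add _ _))// [leRHS]mulrDl lerD//.
  by rewrite cmodM ler_wpM2r ?cmod_ge0.
rewrite !cmodM cmodJ e1 e1' !mul1r.
rewrite (le_trans (cmod_le_add _ _))//.
have -> : 3 * g * (cmod w * cmod z^*) = 2 * g * (cmod w * cmod z) + g * (cmod w * cmod z).
  by rewrite cmodJ; ring.
rewrite lerD//.
  rewrite (le_trans (cmod_le_add _ _))// !cmodM !cmodJ.
  have : cmod err' * cmod z <= g * cmod w * cmod z by rewrite ler_wpM2r ?cmod_ge0.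
  have : cmod w * cmod err <= cmod w * (g * cmod z) by rewrite ler_wpM2l ?cmod_ge0.
  lra.
rewrite cmodM cmodJ.
have : cmod err' * cmod err <= (g * cmod w) * (g * cmod z) by rewrite ler_pM ?cmod_ge0.
move=> /le_trans; apply.
have -> : g * cmod w * (g * cmod z) = g * (g * (cmod w * cmod z)) by ring.
by rewrite ler_wpM2l// ler_piMl// mulr_ge0 ?cmod_ge0.
Qed.

(** A discrete Gronwall estimate. Multiplication by [om] preserves moduli, so the
    relative errors of the steps simply add up. *)
Lemma rotation_gronwall (D : nat -> R[i]) (om : R[i]) (g : nat -> R) (N k : nat) :
  cmod om = 1 -> (forall j, 0 <= g j) ->
  (forall j, (N <= j < N + k)%N -> cmod (D j.+1 - om * D j) <= g j * cmod (D j)) ->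
  \sum_(N <= j < N + k) g j <= 2^-1 ->
  cmod (D (N + k)%N - om ^+ k * D N) <= 2 * (\sum_(N <= j < N + k) g j) * cmod (D N).
Proof.
move=> om1 g0; have omX m : cmod (om ^+ m) = 1.
  by elim: m => [|m ih]; rewrite ?cmod1// exprS cmodM om1 ih mulr1.
elim: k => [|k ih] h S.
  by rewrite addn0 expr0 mul1r subrr big_geq// mulr0 mul0r cmod0.
have sumE : \sum_(N <= j < N + k.+1) g j = \sum_(N <= j < N + k) g j + g (N + k)%N.
  by rewrite addnS big_nat_recr ?leq_addr.
have S' : \sum_(N <= j < N + k) g j <= 2^-1.
  by apply: le_trans S; rewrite sumE lerDl.
have {}ih : cmod (D (N + k)%N - om ^+ k * D N) <= 2 * (\sum_(N <= j < N + k) g j) * cmod (D N).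
  by apply: ih => // j /andP[Nj jk]; rewrite h// Nj addnS ltnS ltnW.
(* The error sum being at most 1/2, the modulus has at most doubled so far. *)
have Dk : cmod (D (N + k)%N) <= 2 * cmod (D N).
  rewrite -[D (N + k)%N](subrK (om ^+ k * D N)) (le_trans (cmod_le_add _ _))//.
  rewrite cmodM omX mul1r (_ : 2 * _ = 1 * cmod (D N) + cmod (D N)); last by ring.
  rewrite lerD2r (le_trans ih)// ler_wpM2r ?cmod_ge0//; lra.
have -> : D (N + k.+1)%N - om ^+ k.+1 * D N =
   (D (N + k).+1 - om * D (N + k)%N) + om * (D (N + k)%N - om ^+ k * D N).
  by rewrite addnS exprS; ring.
rewrite (le_trans (cmod_le_add _ _))// cmodM om1 mul1r.
rewrite sumE mulrDr mulrDl addrC lerD//.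
rewrite (le_trans (h _ _)) ?leq_addr ?addnS//=.
by rewrite -mulrA mulrCA ler_wpM2l.
Qed.

Definition cis (t : R) : R[i] := cos t +i* sin t.

Lemma cmod_cis t : cmod (cis t) = 1.
Proof. by rewrite cmodE cos2Dsin2 sqrtr1. Qed.

Lemma cisX t n : cis t ^+ n = cis (n%:R * t).
Proof.
elim: n => [|n ih].
  by rewrite expr0 mul0r /cis cos0 sin0.
rewrite exprS ih -natr1 mulrDl mul1r [n%:R * t + t]addrC /cis cosD sinD.
by apply/eqP; rewrite eq_complex/= eqxx /=; apply/eqP; ring.
Qed.

Lemma circ_quotient_cis t t' : 0 <= t <= pi -> 0 <= t' <= pi ->
  circ (cos t') * (circ (cos t))^* = cis (t' - t).
Proof.
move=> h h'; rewrite /circ !sine_cos// /cis cosB sinB.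
by apply/eqP; rewrite eq_complex/=; apply/andP; split; apply/eqP; ring.
Qed.

End Gronwall.

(** * The Jost variable and its recurrence *)

Section Recurrence.
Variables (R : realType) (a b : nat -> R).
Hypothesis a_gt0 : forall n : nat, (0 < n)%N -> 0 < a n.
Local Notation p n := (orthonormal_poly a b n).
Implicit Types (n : nat) (x r : R).

(** The one-step transfer matrix at [n] has determinant 1 and trace twice this number,
    so its eigenvalues are [circ] of it and the conjugate. *)
Definition local_cos n x : R := (x - b n) / (2 * a n).
(** Up to normalization, the coordinate of the solution along the eigenvector for [circ].
    In the free case, at [x = 2 * cos t], it is [exp (i * (n + 1) * t)]. *)
Definition jost n x : R[i] :=
  circ (local_cos n x) * (p n).[x]%:C - (p n.-1).[x]%:C.

Lemma poly_step n x : (0 < n)%N ->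
  (p n.+1).[x] = 2 * local_cos n.+1 x * (p n).[x] - a n / a n.+1 * (p n.-1).[x].
Proof.
case: n => // n _; have -> : p n.+2 =
    (a n.+2)^-1 *: (('X - (b n.+2)%:P) * p n.+1 - a n.+1 *: p n) by [].
rewrite [n.+1.-1]/= /local_cos; move: (p n) (p n.+1) => q q1.
rewrite !(hornerZ, hornerD, hornerN, hornerM, hornerX, hornerC).
by field; rewrite gt_eqF ?a_gt0.
Qed.

Lemma Im_jost n x : complex.Im (jost n x) = sine (local_cos n x) * (p n).[x].
Proof. by rewrite /jost /=; ring. Qed.

(** The relation [circ c ^+ 2 = 2 * c * circ c - 1] makes [circ] an eigenvalue; the last
    two terms account for the change of the eigenvector from one step to the next. *)
Lemma jost_step n x : (0 < n)%N -> `|local_cos n.+1 x| <= 1 ->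
  jost n.+1 x = circ (local_cos n.+1 x) * (jost n x +
   ((circ (local_cos n.+1 x) - circ (local_cos n x)) * (p n).[x]%:C
    + (1 - a n / a n.+1)%:C * (p n.-1).[x]%:C)).
Proof.
move=> n0 c1; rewrite {1}/jost poly_step//= /jost.
move: (p n.-1).[x] (p n).[x] (a n / a n.+1) => q v al.
have := circ_sqr c1; move: (circ (local_cos n x)) (local_cos _ x) => e0 c.
rewrite expr2 !(rmorphB, rmorphM) /= !rmorph1.
move: (circ c) => e h.
transitivity (e * e * v%:C - e * (al%:C * q%:C)); last by ring.
by rewrite h; ring.
Qed.

Section Bounds.
Variable r : R.
Hypotheses (r0 : 0 <= r) (r1 : r < 1).
Let s := sine r.
Let s0 : 0 < s. Proof. exact: sine_gt0. Qed.

(** The imaginary part returns [p_n] with a factor that is bounded below away from the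
    band edges, and [p_(n-1)] is what then remains. *)
Lemma jost_poly_le n x : `|local_cos n x| <= r ->
  `|(p n).[x]| <= s^-1 * cmod (jost n x) /\
  `|(p n.-1).[x]| <= (1 + s^-1) * cmod (jost n x).
Proof.
move=> h; have h1 : `|local_cos n x| <= 1 by rewrite (le_trans h)// ltW.
have hp : `|(p n).[x]| <= s^-1 * cmod (jost n x).
  rewrite mulrC ler_pdivlMr//; have := abs_Im_le (jost n x).
  rewrite Im_jost normrM ger0_norm ?sine_ge0// mulrC; apply: le_trans.
  by rewrite ler_wpM2l// sine_ge.
split => //; rewrite -cmod_real.
have -> : (p n.-1).[x]%:C = circ (local_cos n x) * (p n).[x]%:C - jost n x.
  by rewrite /jost opprB addrC subrK.
rewrite (le_trans (cmod_le_sub _ _))// cmodM cmod_circ// mul1r cmod_real.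
by rewrite mulrDl mul1r addrC lerD2l.
Qed.

Lemma jost_step_err n x ka : (0 < n)%N ->
  `|local_cos n x| <= r -> `|local_cos n.+1 x| <= r ->
  `|local_cos n.+1 x - local_cos n x| <= ka -> `|1 - a n / a n.+1| <= ka ->
  exists2 err, jost n.+1 x = circ (local_cos n.+1 x) * (jost n x + err) &
    cmod err <= (1 + s^-1) ^+ 2 * ka * cmod (jost n x).
Proof.
move=> n0 h h' hc ha; have h1 : `|local_cos n.+1 x| <= 1 by rewrite (le_trans h')// ltW.
rewrite jost_step//; eexists; first by [].
have [hp hq] := jost_poly_le h.
rewrite (le_trans (cmod_le_add _ _))// !cmodM !cmod_real.
have ka0 : 0 <= ka by rewrite (le_trans _ hc).
have si : 0 < s^-1 by rewrite invr_gt0.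
have -> : (1 + s^-1) ^+ 2 * ka * cmod (jost n x) =
   ((1 + s^-1) * ka) * (s^-1 * cmod (jost n x)) + ka * ((1 + s^-1) * cmod (jost n x)) by ring.
rewrite lerD// ler_pM ?cmod_ge0//.
rewrite (le_trans (circ_lip r0 r1 h h'))// ler_wpM2l// addr_ge0// ltW//.
Qed.

End Bounds.
End Recurrence.

(** * The Wronskian *)

Section Wronskian.
Variables (R : realType) (a b : nat -> R).
Hypothesis a_gt0 : forall n : nat, (0 < n)%N -> 0 < a n.
Local Notation p n := (orthonormal_poly a b n).
Implicit Types (n : nat) (x r : R).

(** The Christoffel-Darboux formula on the diagonal: the right-hand side grows by
    [p_(n+1) (x) ^ 2] from [n] to [n + 1], and it is [p_0 ^ 2 = 1] for [n = 0]. *)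
Lemma wronskian_ge1 n x :
  1 <= a n.+1 * ((p n.+1)^`().[x] * (p n).[x] - (p n.+1).[x] * (p n)^`().[x]).
Proof.
elim: n => [|n ih].
  have -> : p 1%N = (a 1%N)^-1 *: (('X - (b 1%N)%:P) * 1 - a 0%N *: 0) by [].
  have -> : p 0%N = 1 by [].
  rewrite scaler0 subr0 mulr1 derivZ derivB derivX !derivC subr0.
  rewrite !(hornerZ, hornerD, hornerN, hornerM, hornerX, hornerC).
  by rewrite !mulr1 mulr0 subr0 divff// gt_eqF ?a_gt0.
apply: (le_trans ih).
have -> : p n.+2 =
    (a n.+2)^-1 *: (('X - (b n.+2)%:P) * p n.+1 - a n.+1 *: p n) by [].
move: (p n) (p n.+1) => q q1.
rewrite derivZ derivB derivM derivB derivX !derivC derivZ subr0.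
rewrite !(hornerZ, hornerD, hornerN, hornerM, hornerX, hornerC).
rewrite -subr_ge0.
have h : a n.+2 != 0 by rewrite gt_eqF ?a_gt0.
rewrite [X in 0 <= X](_ : _ = q1.[x] ^+ 2) ?sqr_ge0//.
by field.
Qed.

End Wronskian.

(** * Comparison of two energies *)

Section Tails.
Variable R : realType.

Lemma nneseries_small_tail (d : nat -> R) (m : nat) (eta : R) :
  (forall j, 0 <= d j) -> (\sum_(m <= j <oo) (d j)%:E < +oo)%E -> 0 < eta ->
  exists N0, forall N n, (N0 <= N)%N -> \sum_(N <= j < n) d j <= eta.
Proof.
move=> d0 Soo e0.
pose u n : R := \sum_(m <= j < n) d j.
have ub n : u n <= fine (\sum_(m <= j <oo) (d j)%:E)%E.
  rewrite -lee_fin fineK; last first.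
    by rewrite ge0_fin_numE// nneseries_ge0// => j _ _; rewrite lee_fin.
  by rewrite /u -sumEFin; apply: nneseries_lim_ge => j _; rewrite lee_fin.
have nd : nondecreasing_seq u.
  apply/nondecreasing_seqP => n; rewrite /u.
  have [mn|nm] := leqP m n; first by rewrite big_nat_recr//= lerDl.
  by rewrite !big_geq// ltnW.
have cu : cvgn u.
  apply: nondecreasing_is_cvgn => //.
  by exists (fine (\sum_(m <= j <oo) (d j)%:E)%E) => _ [n _ <-].
have /cvgrPdist_le/(_ _ e0)[N0 _ hN] : u @ \oo --> limn u by [].
exists (maxn m N0) => N n; rewrite geq_max => /andP[mN N0N].
have [Nn|nN] := leqP N n; last by rewrite big_geq ?ltW// ltnW.
have -> : \sum_(N <= j < n) d j = u n - u N.
  by rewrite /u (big_cat_nat mN Nn)/= addrAC subrr add0r.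
have := nondecreasing_cvgn_le nd cu n.
have := hN N N0N.
by rewrite ler_norml => /andP[_]; lra.
Qed.

End Tails.

Section Comparison.
Variables (R : realType) (a b : nat -> R).
Hypothesis a_gt0 : forall n : nat, (0 < n)%N -> 0 < a n.
Implicit Types (n N k : nat) (x y r t eta : R).
Local Notation lc := (local_cos a b).
Local Notation z := (jost a b).

Definition coef_variation n : R := `|a n.+1 - a n| + `|b n.+1 - b n|.

Lemma coef_variation_ge0 n : 0 <= coef_variation n.
Proof. by rewrite addr_ge0. Qed.

Definition near_free eta n := `|a n - 1| <= eta /\ `|b n| <= eta.

Lemma local_cos_near eta n x : eta <= 2^-1 -> near_free eta n -> `|x| <= 2 ->
  `|lc n x - x / 2| <= 3 * eta.
Proof.
move=> e2 [ha hb] hx.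
have an : 2^-1 <= a n by move: ha; rewrite ler_norml; lra.
have a0 : 0 < a n by lra.
have -> : lc n x - x / 2 = (x * (1 - a n) - b n) / (2 * a n).
  by rewrite /local_cos; field; rewrite gt_eqF.
rewrite normrM normfV [`|2 * a n|]ger0_norm ?mulr_ge0 ?(ltW a0)//.
rewrite ler_pdivrMr ?mulr_gt0//.
have hn : `|x * (1 - a n) - b n| <= 3 * eta.
  rewrite (le_trans (ler_normB _ _))// normrM.
  have : `|x| * `|1 - a n| <= 2 * eta by rewrite ler_pM// distrC.
  lra.
have e0 : 0 <= eta by rewrite (le_trans _ hb).
by rewrite (le_trans hn)// ler_peMr ?mulr_ge0//; lra.
Qed.

Lemma local_cosB n x y : 0 < a n -> lc n y - lc n x = (a n)^-1 * (y / 2 - x / 2).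
Proof. by move=> a0; rewrite /local_cos; field; rewrite gt_eqF. Qed.

Lemma near_free_inv eta n : eta <= 2^-1 -> near_free eta n ->
  `|(a n)^-1 - 1| <= 3 * eta /\ `|(a n)^-1| <= 2.
Proof.
move=> e2 [ha hb]; have e0 : 0 <= eta by rewrite (le_trans _ hb).
have an : 2^-1 <= a n by move: ha; rewrite ler_norml; lra.
have a0 : 0 < a n by lra.
have i2 : (a n)^-1 <= 2 by rewrite -[2]invrK lef_pV2 ?posrE.
have i0 : 0 < (a n)^-1 by rewrite invr_gt0.
split; last by rewrite ger0_norm// ltW.
have -> : (a n)^-1 - 1 = (a n)^-1 * (1 - a n) by field; rewrite gt_eqF.
rewrite normrM distrC (@le_trans _ _ (2 * eta))//; last by lra.
by rewrite ler_pM// ger0_norm// ltW.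
Qed.

Lemma local_cos_step eta n x : eta <= 2^-1 -> near_free eta n -> near_free eta n.+1 ->
  `|x| <= 2 -> `|lc n.+1 x - lc n x| <= 5 * coef_variation n.
Proof.
move=> e2 [ha hb] [ha' hb'] hx.
have [an an2] : 2^-1 <= a n /\ a n <= 3/2 by move: ha; rewrite ler_norml; lra.
have an' : 2^-1 <= a n.+1 by move: ha'; rewrite ler_norml; lra.
have a0 : 0 < a n by lra.
have a0' : 0 < a n.+1 by lra.
have -> : lc n.+1 x - lc n x = ((x - b n) * (a n - a n.+1) - (b n.+1 - b n) * a n)
     / (2 * (a n * a n.+1)).
  by rewrite /local_cos; field; rewrite !gt_eqF.
have aa : 2^-1 <= 2 * (a n * a n.+1).
  have : 2^-1 * 2^-1 <= a n * a n.+1 by rewrite ler_pM.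
  lra.
rewrite normrM normfV [`|2 * _|]ger0_norm; last by lra.
rewrite ler_pdivrMr; last by lra.
have hn : `|(x - b n) * (a n - a n.+1) - (b n.+1 - b n) * a n| <= 5 / 2 * coef_variation n.
  rewrite (le_trans (ler_normB _ _))// !normrM /coef_variation.
  have : `|x - b n| * `|a n - a n.+1| <= 5/2 * `|a n.+1 - a n|.
    rewrite distrC ler_pM// ?(distrC (a n))// distrC (le_trans (ler_normB _ _))//; lra.
  have : `|b n.+1 - b n| * `|a n| <= `|b n.+1 - b n| * (5/2).
    by rewrite ler_wpM2l// ger0_norm ?(ltW a0)//; lra.
  lra.
rewrite (le_trans hn)//.
have := coef_variation_ge0 n; nra.
Qed.

Lemma ratio_step eta n : eta <= 2^-1 -> near_free eta n.+1 ->
  `|1 - a n / a n.+1| <= 5 * coef_variation n.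
Proof.
move=> e2 [ha' hb'].
have an' : 2^-1 <= a n.+1 by move: ha'; rewrite ler_norml; lra.
have a0' : 0 < a n.+1 by lra.
have -> : 1 - a n / a n.+1 = (a n.+1 - a n) * (a n.+1)^-1 by field; rewrite gt_eqF.
have i2 : (a n.+1)^-1 <= 2 by rewrite -[2]invrK lef_pV2 ?posrE.
rewrite normrM [`|_^-1|]ger0_norm ?invr_ge0 ?(ltW a0')//.
have : `|a n.+1 - a n| * (a n.+1)^-1 <= `|a n.+1 - a n| * 2 by rewrite ler_wpM2l.
have := normr_ge0 (a n.+1 - a n).
have := normr_ge0 (b n.+1 - b n).
rewrite /coef_variation; lra.
Qed.

(** The argument of this product is the angle between the Jost variables at two
    energies. *)
Definition jost_prod t t' n : R[i] := z n (2 * cos t') * (z n (2 * cos t))^*.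

(** Past an index [N] from which the coefficients are nearly free and have little
    variation left, each step turns the product by [t' - t]. In the error bound, [T] comes
    from the [k] discrepancies of [circ_quotient_lip], each of size [eta * |cos t' - cos t|],
    and 1 from the remaining variation. *)
Lemma jost_pair_rotation r : 0 <= r -> r < 1 -> exists eta0 C, 0 < eta0 /\ 0 < C /\
  forall eta N k T t t', 0 < eta <= eta0 -> (0 < N)%N ->
  (forall n, (N <= n)%N -> near_free eta n) ->
  (forall n, \sum_(N <= j < n) coef_variation j <= eta) ->
  0 <= t <= pi -> 0 <= t' <= pi -> `|cos t| <= r -> `|cos t'| <= r ->
  k%:R * `|cos t' - cos t| <= T -> C * eta * (1 + T) <= 2^-1 ->
  cmod (jost_prod t t' (N + k)%N - cis (k%:R * (t' - t)) * jost_prod t t' N)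
   <= 2 * (C * eta * (1 + T)) * cmod (jost_prod t t' N).
Proof.
move=> r0 r1; pose r' := (1 + r) / 2.
have r'0 : 0 <= r' by rewrite /r'; lra.
have r'1 : r' < 1 by rewrite /r'; lra.
have [K K0 hK] := circ_quotient_lip r'0 r'1.
set M := (1 + (sine r')^-1) ^+ 2.
have M0 : 1 <= M.
  rewrite /M -[leLHS](expr1n _ 2) lerXn2r ?nnegrE ?lerDl ?addr_ge0 ?invr_ge0 ?sine_ge0//.
(* The bound [(1 - r) / 6] keeps [local_cos] below [r' = (1 + r) / 2], and [(5 * M)^-1]
   keeps the relative error of a single step below 1, as [product_step] requires. *)
exists (Num.min ((1 - r) / 6) (Num.min (2^-1) (5 * M)^-1)), (15 * M + 3 * K).
split.
  by rewrite !lt_min; apply/and3P; split; [lra|lra|rewrite invr_gt0; lra].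
split; first by lra.
move=> eta N k T t t' /andP[e0 he] N0 hN hV ht ht' hc hc' hT hS.
move: he; rewrite !le_min => /and3P[e1 e2 e3].
have c2 (u : R) : `|2 * cos u| <= 2.
  by rewrite normrM (ger0_norm (ler0n _ 2)) ler_piMr// cos_max.
have lcr j u : (N <= j)%N -> `|cos u| <= r -> `|lc j (2 * cos u)| <= r'.
  move=> Nj hu; have := local_cos_near e2 (hN j Nj) (c2 u).
  rewrite [2 * cos u]mulrC mulfK// => h.
  rewrite -[lc _ _](subrK (cos u)) (le_trans (ler_normD _ _))// /r'; lra.
have rr' : r <= r' by rewrite /r'; lra.
have v1 j : (N <= j)%N -> coef_variation j <= eta.
  move=> Nj; apply: le_trans (hV j.+1); rewrite big_nat_recr//= lerDr.
  by apply: sumr_ge0 => i _; exact: coef_variation_ge0.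
pose g j := 15 * M * coef_variation j + 3 * K * eta * `|cos t' - cos t|.
have g0 j : 0 <= g j.
  have h1 : 0 <= K * eta by rewrite mulr_ge0 ?ltW.
  rewrite addr_ge0// mulr_ge0 ?coef_variation_ge0//; clear - M0 h1; lra.
have sumg : \sum_(N <= j < N + k) g j <= (15 * M + 3 * K) * eta * (1 + T).
  rewrite big_split/= -mulr_sumr sumr_const_nat addnC addnK -mulr_natr.
  have h1 : 15 * M * (\sum_(N <= j < N + k) coef_variation j) <= 15 * M * eta.
    by rewrite ler_wpM2l//; clear - M0; lra.
  have h2 : 3 * K * eta * `|cos t' - cos t| * k%:R <= 3 * K * eta * T.
    by rewrite -mulrA ler_wpM2l// 1?mulrC// !mulr_ge0// ltW.
  have T0 : 0 <= T by rewrite (le_trans _ hT)// mulr_ge0.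
  have h3 : 0 <= M * eta * T by apply: mulr_ge0 => //; apply: mulr_ge0; [by clear - M0; lra|exact: ltW].
  have h4 : 0 <= K * eta by rewrite mulr_ge0 ?ltW.
  rewrite addnC; clear - h1 h2 h3 h4; lra.
have -> : cis (k%:R * (t' - t)) = cis (t' - t) ^+ k by rewrite cisX.
apply: (le_trans (rotation_gronwall _ g0 _ _)).
- exact: cmod_cis.
- move=> j /andP[Nj _]; have j0 := leq_trans N0 Nj.
  have Nj1 := leqW Nj.
  have gl : 0 <= M * (5 * coef_variation j) <= 1.
    have V0 := coef_variation_ge0 j; have V1 := le_trans (v1 j Nj) e3.
    have h1 : 0 <= M * coef_variation j by apply: mulr_ge0 => //; clear - M0; lra.
    have h2 : 5 * M * coef_variation j <= 5 * M * (5 * M)^-1.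
      by apply: ler_wpM2l => //; clear - M0; lra.
    have h3 : 5 * M * (5 * M)^-1 = 1 by rewrite mulfV// gt_eqF//; clear - M0; lra.
    by apply/andP; split; clear - h1 h2 h3; lra.
  have st u : `|cos u| <= r -> exists2 err, z j.+1 (2 * cos u) =
       circ (lc j.+1 (2 * cos u)) * (z j (2 * cos u) + err) &
      cmod err <= M * (5 * coef_variation j) * cmod (z j (2 * cos u)).
    move=> hu; apply: jost_step_err; rewrite ?lcr//.
      exact: (local_cos_step e2 (hN _ Nj) (hN _ Nj1)).
    exact: ratio_step e2 (hN _ Nj1).
  rewrite /jost_prod; have [err -> herr] := st t hc; have [err' -> herr'] := st t' hc'.
  rewrite -!circ_quotient_cis//.
  apply: (le_trans (product_step _ _ herr herr' gl _)).
  + by rewrite cmod_circ// (le_trans (lcr _ _ _ hc))// ltW.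
  + by rewrite cmod_circ// (le_trans (lcr _ _ _ hc'))// ltW.
  + have [i1 i2] := near_free_inv e2 (hN _ Nj1).
    have nn u : `|lc j.+1 (2 * cos u) - cos u| <= 3 * eta.
      have := local_cos_near e2 (hN _ Nj1) (c2 u).
      by rewrite [2 * cos u / 2]mulrC mulKf.
    apply: (hK _ _ _ _ (a j.+1)^-1 (3 * eta)); rewrite ?lcr//.
    * exact: le_trans hc rr'.
    * exact: le_trans hc' rr'.
    * by rewrite local_cosB ?a_gt0//; congr (_ * _); field.
  rewrite ler_wpM2r ?cmod_ge0// /g; clear - M0; lra.
- exact: le_trans sumg hS.
by rewrite ler_wpM2r ?cmod_ge0// ler_wpM2l.
Qed.

End Comparison.

Section TrigLipschitz.
Variable R : realType.
Implicit Types (u v : R) (f df : R -> R).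

Lemma lip1_of_derive f df : (forall x : R, is_derive x 1 f (df x)) ->
  (forall x, `|df x| <= 1) -> forall u v, `|f v - f u| <= `|v - u|.
Proof.
move=> hf hd u v; wlog uv : u v / u <= v.
  move=> h; have [uv|vu] := leP u v; first exact: h.
  by rewrite distrC (distrC v); apply/h/ltW.
have [|c _ ->] := @MVT_segment _ f df u v uv.
apply: continuous_subspaceT => x.
  by have [] := hf x; move=> /derivable1_diffP /differentiable_continuous.
by rewrite normrM ler_piMl.
Qed.

Lemma cos_lip u v : `|cos v - cos u| <= `|v - u|.
Proof. by apply: lip1_of_derive => x; rewrite normrN sin_max. Qed.

Lemma sin_lip u v : `|sin v - sin u| <= `|v - u|.
Proof. by apply: lip1_of_derive => x; exact: cos_max. Qed.

Lemma cis_lip u v : cmod (cis v - cis u) <= 2 * `|v - u|.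
Proof.
have -> : cis v - cis u = (cos v - cos u)%:C + 'i * (sin v - sin u)%:C.
  by apply/eqP; rewrite eq_complex/=; apply/andP; split; apply/eqP; ring.
rewrite (le_trans (cmod_le_add _ _))// cmodM !cmod_real.
rewrite cmodE expr0n add0r expr1n sqrtr1 mul1r.
by have := cos_lip u v; have := sin_lip u v; lra.
Qed.

End TrigLipschitz.

Section FixedIndex.
Variables (R : realType) (a b : nat -> R).
Hypothesis a_gt0 : forall n : nat, (0 < n)%N -> 0 < a n.
Implicit Types (n N k : nat) (x y r t eta : R).
Local Notation p n := (orthonormal_poly a b n).
Local Notation lc := (local_cos a b).
Local Notation z := (jost a b).

(** Consecutive polynomials have no common zero, as their Wronskian does not vanish;
    compactness makes this uniform. *)
Lemma poly_consecutive_bound n : (0 < n)%N ->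
  exists2 m, 0 < m & forall x, `|x| <= 2 -> m <= (p n).[x] ^+ 2 + (p n.-1).[x] ^+ 2.
Proof.
case: n => // n _ /=.
pose h := p n.+1 ^+ 2 + p n ^+ 2.
have hE x : h.[x] = (p n.+1).[x] ^+ 2 + (p n).[x] ^+ 2.
  by rewrite /h hornerD !horner_exp.
have [||c _ hc] := @EVT_min R (fun x => h.[x]) (-2) 2.
- by lra.
- by apply: continuous_subspaceT => x; exact: continuous_horner.
exists (h.[c]); last first.
  move=> x hx; rewrite -hE; apply: hc; rewrite in_itv/=.
  by move: hx; rewrite ler_norml.
rewrite lt_neqAle eq_sym hE addr_ge0 ?sqr_ge0// andbT.
apply/negP; rewrite paddr_eq0 ?sqr_ge0// !sqrf_eq0 => /andP[/eqP h1 /eqP h0].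
have := wronskian_ge1 b a_gt0 n c; rewrite h1 h0; lra.
Qed.

Lemma jost_modulus_bound n r : (0 < n)%N -> 0 <= r < 1 ->
  exists2 m, 0 < m & forall x, `|x| <= 2 -> `|lc n x| <= r -> m <= cmod (z n x).
Proof.
move=> n0 /andP[r0 r1]; have [m m0 hm] := poly_consecutive_bound n0.
have s0 := sine_gt0 r0 r1.
set M := 2 * (1 + (sine r)^-1) ^+ 2.
have si : 0 < (sine r)^-1 by rewrite invr_gt0.
have M0 : 0 < M by rewrite /M mulr_gt0// exprn_gt0// addr_gt0.
exists (Num.sqrt (m / M)); first by rewrite sqrtr_gt0 divr_gt0.
move=> x hx hl; have [h1 h2] := jost_poly_le r0 r1 hl.
rewrite -[leRHS]ger0_norm ?cmod_ge0// -sqrtr_sqr ler_wsqrtr//.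
rewrite ler_pdivrMr// (le_trans (hm x hx))//.
rewrite -(real_normK (num_real (p n).[x])) -(real_normK (num_real (p n.-1).[x])).
have h3 : `|(p n).[x]| <= (1 + (sine r)^-1) * cmod (z n x).
  by rewrite (le_trans h1)// ler_wpM2r ?cmod_ge0// lerDr.
have := cmod_ge0 (z n x); have := normr_ge0 (p n).[x]; have := normr_ge0 (p n.-1).[x].
have k1 : `|(p n).[x]| ^+ 2 <= ((1 + (sine r)^-1) * cmod (z n x)) ^+ 2.
  by rewrite lerXn2r// nnegrE// mulr_ge0 ?cmod_ge0// addr_ge0// ltW.
have k2 : `|(p n.-1).[x]| ^+ 2 <= ((1 + (sine r)^-1) * cmod (z n x)) ^+ 2.
  by rewrite lerXn2r// nnegrE// mulr_ge0 ?cmod_ge0// addr_ge0// ltW.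
move: k1 k2; rewrite !exprMn /M; lra.
Qed.

Lemma jost_lip n r : (0 < n)%N -> 0 <= r < 1 ->
  exists2 L, 0 < L & forall x y, `|x| <= 2 -> `|y| <= 2 ->
    `|lc n x| <= r -> `|lc n y| <= r -> cmod (z n y - z n x) <= L * `|y - x|.
Proof.
move=> n0 /andP[r0 r1].
have [k1 k11 hk1] := poly_lipshitz (p n) (-2) 2.
have [k2 k21 hk2] := poly_lipshitz (p n.-1) (-2) 2.
have itv x : `|x| <= 2 -> x \in `[(-2 : R), 2] by rewrite in_itv/= ler_norml.
have [B B0 hB] : exists2 B, 0 <= B & forall x, `|x| <= 2 -> `|(p n).[x]| <= B.
  exists (`|(p n).[0]| + k1 * 2).
    by rewrite addr_ge0// mulr_ge0//; lra.
  move=> x hx; rewrite -[(p n).[x]](subrK (p n).[0]) addrC.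
  rewrite (le_trans (ler_normD _ _))// lerD2l.
  have z0 : 0 \in `[(-2 : R), 2] by rewrite in_itv/=; lra.
  rewrite (le_trans (hk1 _ _ z0 (itv _ hx)))// subr0 ler_wpM2l//; lra.
set L := 1 + (sine r)^-1.
have L0 : 0 < L by rewrite /L addr_gt0// invr_gt0 sine_gt0.
have an := a_gt0 n0.
exists (L * (2 * a n)^-1 * B + k1 + k2).
  rewrite ltr_pwDr//; first by lra.
  by rewrite addr_ge0 ?mulr_ge0 ?invr_ge0// ?(ltW L0) ?mulr_ge0 ?(ltW an)//; lra.
move=> x y hx hy hlx hly.
have -> : z n y - z n x = (circ (lc n y) - circ (lc n x)) * (p n).[y]%:C
   + circ (lc n x) * ((p n).[y] - (p n).[x])%:C - ((p n.-1).[y] - (p n.-1).[x])%:C.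
  by rewrite /jost !rmorphB/=; ring.
rewrite (le_trans (cmod_le_sub _ _))// cmod_real [leRHS]mulrDl lerD//; last first.
  by apply: hk2; exact: itv.
rewrite (le_trans (cmod_le_add _ _))// !cmodM !cmod_real mulrDl lerD//; last first.
  rewrite cmod_circ ?(le_trans hlx (ltW r1))// mul1r.
  by apply: hk1; exact: itv.
have -> : L * (2 * a n)^-1 * B * `|y - x| = (L * ((2 * a n)^-1 * `|y - x|)) * B by ring.
rewrite ler_pM ?cmod_ge0 ?hB//.
rewrite (le_trans (circ_lip r0 r1 hlx hly))// ler_wpM2l ?(ltW L0)//.
have -> : lc n y - lc n x = (2 * a n)^-1 * (y - x).
  by rewrite /local_cos; field; rewrite gt_eqF.
by rewrite normrM [`|_^-1|]ger0_norm// invr_ge0 mulr_ge0// ltW.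
Qed.

(** At a fixed index the Jost variable is Lipschitz in the energy and bounded away from
    0, so that nearby energies leave its direction almost unchanged. *)
Lemma jost_prod_near_diag n r eta : (0 < n)%N -> 0 <= r < 1 -> 0 < eta ->
  exists2 d, 0 < d & forall t t', `|lc n (2 * cos t)| <= r -> `|lc n (2 * cos t')| <= r ->
    `|cos t' - cos t| <= d ->
    0 < cmod (z n (2 * cos t)) /\
    cmod (jost_prod a b t t' n - (cmod (z n (2 * cos t)) ^+ 2)%:C)
      <= eta * cmod (z n (2 * cos t)) ^+ 2.
Proof.
move=> n0 r01 e0; have [m m0 hm] := jost_modulus_bound n0 r01.
have [L L0 hL] := jost_lip n0 r01.
have c2 (u : R) : `|2 * cos u| <= 2.
  by rewrite normrM (ger0_norm (ler0n _ 2)) ler_piMr// cos_max.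
exists (eta * m / (2 * L)); first by rewrite divr_gt0 ?mulr_gt0.
move=> t t' ht ht' hd; have hz := hm _ (c2 t) ht.
split; first exact: lt_le_trans hz.
rewrite -mul_conj /jost_prod -mulrBl cmodM cmodJ expr2 mulrA ler_wpM2r ?cmod_ge0//.
rewrite (le_trans (hL _ _ _ _ _ _))//.
rewrite -mulrBr normrM (ger0_norm (ler0n _ 2)).
move: hd; rewrite ler_pdivlMr ?mulr_gt0// => hd.
have : eta * m <= eta * cmod (z n (2 * cos t)) by rewrite ler_pM2l.
lra.
Qed.

End FixedIndex.

Section Rotation.
Variables (R : realType) (a b : nat -> R).
Hypothesis a_gt0 : forall n : nat, (0 < n)%N -> 0 < a n.
Hypotheses (a_cvg : a n @[n --> \oo] --> (1 : R)) (b_cvg : b n @[n --> \oo] --> (0 : R)).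
Implicit Types (n N k : nat) (x y r t eta : R).
Local Notation lc := (local_cos a b).
Local Notation z := (jost a b).

Lemma eventually_near_free eta : 0 < eta ->
  exists N0, forall n, (N0 <= n)%N -> near_free a b eta n.
Proof.
move=> e0; move/cvgrPdist_le: a_cvg => /(_ _ e0)[N1 _ h1].
move/cvgrPdist_le: b_cvg => /(_ _ e0)[N2 _ h2].
exists (maxn N1 N2) => n; rewrite geq_max => /andP[n1 n2]; split.
  by have := h1 n n1; rewrite /= distrC.
by have := h2 n n2; rewrite /= sub0r normrN.
Qed.

Lemma eventually_local_cos r : 0 <= r < 1 ->
  exists N0, forall n, (N0 <= n)%N -> forall t, `|cos t| <= r ->
    `|lc n (2 * cos t)| <= (1 + r) / 2.
Proof.
move=> /andP[r0 r1]; pose e := Num.min (2^-1) ((1 - r) / 6).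
have e0 : 0 < e by rewrite /e lt_min; apply/andP; split; lra.
have [N0 h] := eventually_near_free e0.
exists N0 => n /h hn t ht.
have [e1 e2] : e <= 2^-1 /\ e <= (1 - r) / 6 by rewrite /e !ge_min !lexx orbT.
have c2 : `|2 * cos t| <= 2.
  by rewrite normrM (ger0_norm (ler0n _ 2)) ler_piMr// cos_max.
have := local_cos_near e1 hn c2.
rewrite [2 * cos t]mulrC mulfK// => hl.
rewrite -[lc _ _](subrK (cos t)) (le_trans (ler_normD _ _))//; lra.
Qed.

Hypothesis bounded_variation :
  (\sum_(1 <= n <oo) (`|a n.+1 - a n| + `|b n.+1 - b n|)%:E < +oo)%E.

(** The comparison principle on which the rest depends. Choosing first [N], then [n] large,
    leaves three errors: the steps past [N] ([jost_pair_rotation]), the start at [N]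
    ([jost_prod_near_diag]), and the angle [N * (t' - t)], which tends to 0. *)
Lemma jost_prod_rotation r T eta : 0 <= r < 1 -> 0 <= T -> 0 < eta ->
  exists2 n0, (0 < n0)%N & forall n t t', (n0 <= n)%N ->
    0 <= t <= pi -> 0 <= t' <= pi -> `|cos t| <= r -> `|cos t'| <= r ->
    n%:R * `|t' - t| <= T ->
  exists2 A : R, 0 < A &
    cmod (jost_prod a b t t' n - A%:C * cis (n%:R * (t' - t))) <= eta * A.
Proof.
move=> r01 T0 eta_gt0; have /andP[r0 r1] := r01.
have [eta0 [C [eta00 [C0 hrot]]]] := jost_pair_rotation b a_gt0 r0 r1.
have CT : 0 < C * (1 + T) by rewrite mulr_gt0// ltr_pwDl.
pose e := Num.min eta0 (Num.min (2^-1) (eta / 8) / (C * (1 + T))).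
have m0 : 0 < Num.min (2^-1) (eta / 8) by rewrite lt_min invr_gt0 ltr0n divr_gt0.
have e0 : 0 < e by rewrite /e lt_min eta00 divr_gt0.
have [N1 hN1] := eventually_near_free e0.
have [N2 hN2] := nneseries_small_tail (@coef_variation_ge0 _ a b) bounded_variation e0.
have [N3 hN3] := eventually_local_cos r01.
pose N := maxn 1 (maxn N1 (maxn N2 N3)).
have [N_gt0 [N1N [N2N N3N]]] : (0 < N)%N /\ (N1 <= N)%N /\ (N2 <= N)%N /\ (N3 <= N)%N.
  by rewrite /N !leq_max !leqnn !orbT.
pose e' := Num.min 1 (eta / 4).
have e'0 : 0 < e' by rewrite /e' lt_min ltr01 divr_gt0.
have r'01 : 0 <= (1 + r) / 2 < 1 by apply/andP; split; lra.
have [d d0 hd] := jost_prod_near_diag b a_gt0 N_gt0 r'01 e'0.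
pose X := Num.max (T / d) (8 * N%:R * T / eta).
have X0 : 0 <= X by rewrite /X le_max divr_ge0// ltW.
exists (maxn N (Num.bound X)); first by rewrite leq_max N_gt0.
move=> n t t'; rewrite geq_max => /andP[Nn Xn] ht ht' hc hc' hT.
have {Xn} nX : X <= n%:R.
  by rewrite (le_trans (ltW (archi_boundP X0)))// ler_nat.
have n0 : 0 < n%:R :> R by rewrite ltr0n (leq_trans N_gt0).
have [nX1 nX2] : T / d <= n%:R /\ 8 * N%:R * T / eta <= n%:R.
  by move: nX; rewrite /X ge_max => /andP.
have htt : `|t' - t| <= d.
  move: nX1; rewrite ler_pdivrMr// => h.
  by rewrite -(ler_pM2l n0) (le_trans hT).
have cc := cos_lip t t'.
have [A0 hA] := hd t t' (hN3 _ N3N _ hc) (hN3 _ N3N _ hc') (le_trans cc htt).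
set A := cmod (z N (2 * cos t)) ^+ 2 in hA *.
have {}A0 : 0 < A by rewrite exprn_gt0.
exists A => //.
have Ce : C * e * (1 + T) <= Num.min (2^-1) (eta / 8).
  rewrite mulrAC -ler_pdivlMl// mulrC ge_min; apply/orP; right.
  by rewrite lexx.
have [Ce1 Ce2] : C * e * (1 + T) <= 2^-1 /\ C * e * (1 + T) <= eta / 8.
  by move: Ce; rewrite le_min => /andP.
have he : 0 < e <= eta0 by rewrite e0 /e ge_min lexx.
have kT : (n - N)%:R * `|cos t' - cos t| <= T.
  by rewrite (le_trans _ hT)// ler_pM// ler_nat leq_subr.
have := hrot e N (n - N)%N T t t' he N_gt0 (fun m Nm => hN1 m (leq_trans N1N Nm))
  (fun m => hN2 N m N2N) ht ht' hc hc' kT Ce1.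
rewrite subnKC// => h1.
have [e'1 e'2] : e' <= 1 /\ e' <= eta / 4 by rewrite /e' !ge_min !lexx orbT.
set DN := jost_prod a b t t' N in h1 hA.
have hDN : cmod DN <= 2 * A.
  rewrite -[DN](subrK A%:C) (le_trans (cmod_le_add _ _))// cmod_real ger0_norm ?(ltW A0)//.
  have : e' * A <= 1 * A by rewrite ler_wpM2r// ltW.
  clear - hA; lra.
set u := (n - N)%:R * (t' - t) in h1.
(* The three errors are given [eta / 2], [eta / 4] and [eta / 4]. *)
have -> : jost_prod a b t t' n - A%:C * cis (n%:R * (t' - t)) =
  (jost_prod a b t t' n - cis u * DN) + cis u * (DN - A%:C)
  - A%:C * (cis (n%:R * (t' - t)) - cis u) by ring.
rewrite (le_trans (cmod_le_sub _ _))//.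
have h3 : cmod (A%:C * (cis (n%:R * (t' - t)) - cis u)) <= eta / 4 * A.
  rewrite cmodM cmod_real ger0_norm ?(ltW A0)// mulrC ler_wpM2r ?(ltW A0)//.
  rewrite (le_trans (cis_lip _ _))//.
  have -> : n%:R * (t' - t) - u = N%:R * (t' - t) by rewrite /u natrB//; ring.
  rewrite normrM normr_nat.
  move: nX2; rewrite ler_pdivrMr// => nX2.
  rewrite -(ler_pM2l n0).
  have : N%:R * (n%:R * `|t' - t|) <= N%:R * T by rewrite ler_wpM2l.
  clear - nX2; lra.
have h2 : cmod (jost_prod a b t t' n - cis u * DN + cis u * (DN - A%:C)) <=
   eta / 2 * A + eta / 4 * A.
  rewrite (le_trans (cmod_le_add _ _))// lerD//.
    rewrite (le_trans h1)// (@le_trans _ _ (2 * (eta / 8) * (2 * A)))//; last by clear - A0; lra.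
    by rewrite ler_pM ?cmod_ge0 ?mulr_ge0 ?(ltW C0) ?(ltW e0) ?addr_ge0// ler_wpM2l.
  rewrite cmodM cmod_cis mul1r (le_trans hA)// ler_wpM2r// ltW//.
clear - h2 h3; lra.
Qed.

End Rotation.

(** * Sign changes and successive zeros *)

Section SignChanges.
Variable R : realType.
Implicit Types (z w : R[i]) (A eta th : R).

(** Here [w] is nearly a negative multiple of [z]; the last hypothesis prevents [z] from
    being so close to the real axis that the error decides the sign of [Im w]. *)
Lemma half_turn_flips_Im z w A eta : 0 < A -> eta <= 4^-1 ->
  cmod (w * z^* - A%:C * cis pi) <= eta * A ->
  2 * eta * `|complex.Re z| < `|complex.Im z| ->
  complex.Im w * complex.Im z < 0.
Proof.
move=> A0 e4 h hz; have e0 : 0 <= eta.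
  by rewrite -(pmulr_lge0 _ A0) (le_trans _ h)// cmod_ge0.
have := le_trans (abs_Re_le _) h; have := le_trans (abs_Im_le _) h.
rewrite /cis cospi sinpi; case: z hz {h} => x y /=; case: w => u v /= hz.
rewrite !(mulr0, mul0r, mulrN1, addr0, subr0, opprK, opprB, oppr0, mulrN).
rewrite !ler_norml => /andP[i1 i2] /andP[d1 d2].
have y0 : 0 < `|y| by rewrite (le_lt_trans _ hz)// !mulr_ge0.
have y2 : 0 < y ^+ 2 by rewrite -(real_normK (num_real y)) exprn_gt0.
set ID := v * x - u * y in i1 i2.
set RD := u * x + v * y in d1 d2.
have key : v * y * (x ^+ 2 + y ^+ 2) = RD * y ^+ 2 + ID * (x * y).
  by rewrite /RD /ID; ring.
have n1 : `|ID| <= eta * A by rewrite ler_norml /ID; apply/andP; split; lra.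
have n2 : `|ID| * `|x * y| <= A * (y ^+ 2 / 2).
  apply: le_trans (ler_wpM2r (normr_ge0 _) n1) _.
  rewrite mulrAC mulrC ler_wpM2l ?(ltW A0)// normrM.
  rewrite -(real_normK (num_real y)) expr2.
  have : 2 * eta * `|x| * `|y| <= `|y| * `|y| by rewrite ler_wpM2r// ltW.
  lra.
have n3 : ID * (x * y) <= A * (y ^+ 2 / 2).
  by rewrite (le_trans _ n2)// -normrM ler_norm.
have n4 : RD * y ^+ 2 <= (eta * A - A) * y ^+ 2.
  by rewrite ler_wpM2r ?(ltW y2)//; lra.
have n5 : eta * (A * y ^+ 2) <= 4^-1 * (A * y ^+ 2).
  by rewrite ler_wpM2r// mulr_ge0// ltW.
have n6 : 0 < A * y ^+ 2 by rewrite mulr_gt0.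
have n7 : 0 < x ^+ 2 + y ^+ 2 by rewrite ltr_wpDl// sqr_ge0.
rewrite -(pmulr_llt0 _ n7) key; lra.
Qed.

(** If [|Im| <= 2 * eta * |Re|] held for both numbers, then [Im (w * conj z)] would be at
    most [4 * eta * |z| * |w| <= 8 * eta * A], while it is at least
    [(sin th - eta) * A]. *)
Lemma rotated_pair_not_both_real z w A eta th : 0 < A -> 0 <= eta <= 4^-1 ->
  cmod (w * z^* - A%:C * cis th) <= eta * A -> 9 * eta < sin th ->
  2 * eta * `|complex.Re z| < `|complex.Im z| \/
  2 * eta * `|complex.Re w| < `|complex.Im w|.
Proof.
move=> A0 /andP[e0 e4] h hth.
have [|hz] := ltP (2 * eta * `|complex.Re z|) `|complex.Im z|; first by left.
have [|hw] := ltP (2 * eta * `|complex.Re w|) `|complex.Im w|; first by right.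
exfalso.
have zw : cmod z * cmod w <= 2 * A.
  rewrite mulrC -(cmodJ z) -cmodM -[_ * _^*](subrK (A%:C * cis th)).
  rewrite (le_trans (cmod_le_add _ _))// cmodM cmod_cis mulr1 cmod_real ger0_norm ?(ltW A0)//.
  have : eta * A <= 1 * A by rewrite ler_wpM2r ?(ltW A0)//; lra.
  lra.
have := le_trans (abs_Im_le _) h.
have xx : `|complex.Re z| * `|complex.Re w| <= 2 * A.
  by rewrite (le_trans _ zw)// ler_pM// abs_Re_le.
move: hz hw xx; rewrite /cis; case: z {h zw} => x y /=; case: w => u v /= hz hw xx.
rewrite !(mul0r, addr0) ler_norml => /andP[h _].
have n1 : `|v| * `|x| <= 2 * eta * `|u| * `|x| by rewrite ler_wpM2r.
have n2 : `|y| * `|u| <= 2 * eta * `|x| * `|u| by rewrite ler_wpM2r.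
have n3 : eta * (`|x| * `|u|) <= eta * (2 * A) by rewrite ler_wpM2l.
have n4 := ler_norm (v * x); have n5 := ler_norm (- (y * u)).
rewrite normrN !normrM in n4 n5.
have n6 : A * (9 * eta) < A * sin th by rewrite ltr_pM2l.
lra.
Qed.

(** Dividing [p] by its factors at [x] and [y] leaves a polynomial of constant sign, so
    [p^`()] has opposite signs at the two ends; and [q] has the sign of [p^`()] there. *)
Lemma successive_roots_opposite (p q : {poly R}) (x y : R) : x < y ->
  root p x -> root p y -> (forall u, x < u < y -> ~~ root p u) ->
  0 < p^`().[x] * q.[x] -> 0 < p^`().[y] * q.[y] -> q.[x] * q.[y] < 0.
Proof.
move=> xy /factor_theorem[s1 ps1] py nr hx hy.
have : root s1 y.
  move: py; rewrite ps1 rootM => /orP[//|].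
  by rewrite root_XsubC => /eqP yx; rewrite yx ltxx in xy.
move=> /factor_theorem[s ss]; move: ps1; rewrite {s1}ss => ps.
have dx : p^`().[x] = (x - y) * s.[x].
  rewrite ps !derivM !derivXsubC !mulr1 !(hornerXsubC, hornerD, hornerM); ring.
have dy : p^`().[y] = (y - x) * s.[y].
  by rewrite ps !derivM !derivXsubC !mulr1 !(hornerXsubC, hornerD, hornerM); ring.
have sxy : 0 < s.[x] * s.[y].
  rewrite ltNge; apply/negP => /(polyrcf.poly_ivt (ltW xy))[u].
  rewrite in_itv/= => /andP[xu uy] /rootP su.
  have [ux|ux] := eqVneq u x; first by rewrite dx -ux su mulr0 mul0r ltxx in hx.
  have [uy'|uy'] := eqVneq u y; first by rewrite dy -uy' su mulr0 mul0r ltxx in hy.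
  have := nr u; rewrite !lt_neqAle eq_sym ux xu uy' uy => /(_ isT) /negP; apply.
  by rewrite ps /root !hornerM su !mul0r.
have pos : 0 < (p^`().[x] * q.[x]) * (p^`().[y] * q.[y]) by rewrite mulr_gt0.
have neg : p^`().[x] * p^`().[y] < 0.
  rewrite dx dy mulrACA nmulr_rlt0// nmulr_rlt0 ?subr_lt0// subr_gt0//.
by move: pos; rewrite mulrACA nmulr_rgt0.
Qed.

End SignChanges.

Section CosOrder.
Variable R : realType.
Implicit Types t u v r : R.

Lemma cos_ltE t u : 0 <= t <= pi -> 0 <= u <= pi -> (cos u < cos t) = (t < u).
Proof. by move=> ht hu; rewrite ltr_cos. Qed.

Lemma cos_leE t u : 0 <= t <= pi -> 0 <= u <= pi -> (cos u <= cos t) = (t <= u).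
Proof. by move=> ht hu; rewrite !leNgt cos_ltE. Qed.

Lemma abs_cos_between t u v r : 0 <= t -> v <= pi -> t <= u <= v ->
  `|cos t| <= r -> `|cos v| <= r -> `|cos u| <= r.
Proof.
move=> t0 vp /andP[tu uv]; rewrite !ler_norml => /andP[_ h1] /andP[h2 _].
have ht : 0 <= t <= pi by rewrite t0 (le_trans tu)// (le_trans uv).
have hu : 0 <= u <= pi by rewrite (le_trans t0)// (le_trans uv).
have hv : 0 <= v <= pi by rewrite vp andbT (le_trans t0)// (le_trans tu).
by rewrite (le_trans h2) ?(le_trans _ h1) ?cos_leE.
Qed.

Lemma two_cos_preimage x t u : 0 <= t -> u <= pi -> t < u ->
  2 * cos u < x < 2 * cos t -> exists2 v, t < v < u & x = 2 * cos v.
Proof.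
move=> t0 up tu /andP[ux xt].
have ht : 0 <= t <= pi by rewrite t0 (le_trans (ltW tu)).
have hu : 0 <= u <= pi by rewrite up andbT (le_trans t0)// ltW.
have hx : -1 <= x / 2 <= 1.
  by have := cos_le1 t; have := cos_geN1 u; lra.
have hv : 0 <= acos (x / 2) <= pi by rewrite acos_ge0 ?acos_lepi.
have cv : cos (acos (x / 2)) = x / 2 by rewrite acosK// in_itv.
exists (acos (x / 2)); last by rewrite cv; field.
by apply/andP; split; rewrite -cos_ltE// cv; lra.
Qed.

Lemma pi_lt4 : pi < 4 :> R.
Proof. by have := @pihalf_lt2 R; lra. Qed.

End CosOrder.

Section Zeros.
Variables (R : realType) (a b : nat -> R).
Hypothesis a_gt0 : forall n : nat, (0 < n)%N -> 0 < a n.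
Hypotheses (a_cvg : a n @[n --> \oo] --> (1 : R)) (b_cvg : b n @[n --> \oo] --> (0 : R)).
Hypothesis bounded_variation :
  (\sum_(1 <= n <oo) (`|a n.+1 - a n| + `|b n.+1 - b n|)%:E < +oo)%E.
Implicit Types (n N k : nat) (x y r t eta del : R).
Local Notation p n := (orthonormal_poly a b n).
Local Notation lc := (local_cos a b).
Local Notation z := (jost a b).

Local Tactic Notation "lra_from" ne_hyp_list(hs) :=
  revert hs; clear - a_gt0 a_cvg b_cvg bounded_variation; intros; lra.

Lemma eventually_sine_local_cos_gt0 r : 0 <= r < 1 ->
  exists N0, forall n, (N0 <= n)%N -> forall t, `|cos t| <= r ->
    0 < sine (lc n (2 * cos t)).
Proof.
move=> r01; have [N0 h] := eventually_local_cos a_cvg b_cvg r01.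
exists N0 => n /h hn t /hn ht; move: r01 => /andP[r0 r1].
rewrite (lt_le_trans _ (sine_ge ht))// sine_gt0//; lra.
Qed.

(** A half turn of the Jost variable forces a sign change of [p_n], unless that
    variable is nearly real at the start; of two starting points a little apart, at
    most one is exposed to this exception. The extra length [del] of the window makes room
    for both of them, [del / 3] and [2 * del / 3]. *)
Lemma root_in_window r del : 0 <= r < 1 -> 0 < del < 1 ->
  exists2 n0, (0 < n0)%N & forall n t, (n0 <= n)%N ->
    0 <= t -> t + (pi + del) / n%:R <= pi ->
    `|cos t| <= r -> `|cos (t + (pi + del) / n%:R)| <= r ->
  exists2 v, t < v < t + (pi + del) / n%:R & root (p n) (2 * cos v).
Proof.
move=> r01 /andP[d0 d1].
pose s := sin (del / 3).
have pi2 := @pi_ge2 R; have pi4 := @pi_lt4 R.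
have s0 : 0 < s by apply: sin_gt0_pi; apply/andP; split; lra.
pose eta := Num.min 4^-1 (s / 10).
have [e4 es] : eta <= 4^-1 /\ eta <= s / 10 by rewrite /eta !ge_min !lexx orbT.
have e0 : 0 < eta by rewrite /eta lt_min; apply/andP; split; lra.
have [n1 n10 h1] := jost_prod_rotation a_gt0 a_cvg b_cvg bounded_variation r01
  (ler0n _ 4) e0.
have [n2 h2] := eventually_sine_local_cos_gt0 r01.
exists (maxn n1 n2); first by rewrite leq_max n10.
move=> n t; rewrite geq_max => /andP[n1n /h2 {}h2] t0 tp ct ct'.
have n0 : 0 < n%:R :> R by rewrite ltr0n (leq_trans n10).
pose ph u : R := t + u / n%:R.
have phle u v : (ph u <= ph v) = (u <= v) by rewrite lerD2l ler_pM2r ?invr_gt0.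
have phlt u v : (ph u < ph v) = (u < v) by rewrite ltrD2l ltr_pM2r ?invr_gt0.
have ph0 : ph 0 = t by rewrite /ph mul0r addr0.
have phB u v : n%:R * (ph v - ph u) = v - u by rewrite /ph; field; rewrite gt_eqF.
have rng u : 0 <= u <= pi + del -> 0 <= ph u <= pi /\ `|cos (ph u)| <= r.
  move=> /andP[u0 u1]; have tu : t <= ph u by rewrite -ph0 phle.
  have ut : ph u <= ph (pi + del) by rewrite phle.
  split; first by rewrite (le_trans t0 tu) (le_trans ut tp).
  by apply: (abs_cos_between t0 tp _ ct ct'); rewrite tu.
have prod u v : 0 <= u -> u <= v -> v <= pi + del -> v - u <= 4 ->
    exists2 A, 0 < A & cmod (z n (2 * cos (ph v)) * (z n (2 * cos (ph u)))^*
      - A%:C * cis (v - u)) <= eta * A.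
  move=> u0 uv v1 vu.
  have [|Hu1 Hu2] := rng u; first by rewrite u0 (le_trans uv v1).
  have [|Hv1 Hv2] := rng v; first by rewrite v1 (le_trans u0 uv).
  have := h1 n (ph u) (ph v) n1n Hu1 Hv1 Hu2 Hv2.
  rewrite phB; apply.
  rewrite ger0_norm ?subr_ge0 ?phle// phB//.
have robust : exists u, del / 3 <= u <= 2 * del / 3 /\
    2 * eta * `|complex.Re (z n (2 * cos (ph u)))| < `|complex.Im (z n (2 * cos (ph u)))|.
  have q1 : 0 <= del / 3 by lra_from d0.
  have q2 : del / 3 <= 2 * del / 3 by lra_from d0.
  have q3 : 2 * del / 3 <= pi + del by lra_from d0 pi2.
  have q4 : 2 * del / 3 - del / 3 <= 4 by lra_from d0 d1.
  have [A A0 hA] := prod _ _ q1 q2 q3 q4.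
  have hd : 2 * del / 3 - del / 3 = del / 3 by field.
  rewrite hd in hA.
  have e04 : 0 <= eta <= 4^-1 by rewrite ltW.
  have [|h|h] := rotated_pair_not_both_real A0 e04 hA.
  - by rewrite -/s; lra.
  - by exists (del / 3); split => //; apply/andP; split; lra_from d0.
  - by exists (2 * del / 3); split => //; apply/andP; split; lra_from d0.
have [u [/andP[u1 u2] hu]] := robust.
have q1 : 0 <= u by lra_from u1 d0.
have q2 : u <= u + pi by lra_from pi2.
have q3 : u + pi <= pi + del by lra_from u2 d0.
have q4 : u + pi - u <= 4 by lra_from pi4.
have [A A0 hA] := prod _ _ q1 q2 q3 q4.
rewrite [u + pi]addrC addrK in hA.
have := half_turn_flips_Im A0 e4 hA hu.
rewrite !Im_jost.
have [|Hu1 Hu2] := rng u; first by apply/andP; split; lra_from u1 u2 d0 pi2.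
have [|Hv1 Hv2] := rng (pi + u); first by apply/andP; split; lra_from u1 u2 d0 pi2.
rewrite mulrACA pmulr_rlt0 ?mulr_gt0 ?h2// => hneg.
have uv : ph u < ph (pi + u) by rewrite phlt; lra_from pi2.
have [|x] := poly_ivtoo _ hneg.
  by rewrite ler_pM2l// cos_leE// ltW.
rewrite in_itv/= => hx rx.
have /andP[Hu1' _] := Hu1; have /andP[_ Hv1'] := Hv1.
have [v /andP[uv1 vu] xE] := two_cos_preimage Hu1' Hv1' uv hx.
exists v; last by rewrite -xE.
have w1 : t <= ph u by rewrite -ph0 phle; lra_from u1 d0.
have w2 : ph (pi + u) <= ph (pi + del) by rewrite phle; lra_from u2 d0.
by rewrite (le_lt_trans w1 uv1) (lt_le_trans vu w2).
Qed.

(** At successive roots the Jost variable is real and, like [p_(n-1)], has opposite signs,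
    so the angle in between is an odd multiple of [pi] up to a small error; and
    [root_in_window] leaves no room for more than one half turn. *)
Lemma successive_roots_angle r del : 0 <= r < 1 -> 0 < del < 1 ->
  exists2 n0, (0 < n0)%N & forall n t t', (n0 <= n)%N ->
    0 <= t -> t < t' -> t' <= pi -> `|cos t| <= r -> `|cos t'| <= r ->
    root (p n) (2 * cos t) -> root (p n) (2 * cos t') ->
    (forall x, 2 * cos t' < x < 2 * cos t -> ~~ root (p n) x) ->
    `|n%:R * (t' - t) - pi| <= del.
Proof.
move=> r01 /andP[d0 d1].
have pi2 := @pi_ge2 R; have pi4 := @pi_lt4 R.
have [n1 n10 h1] := root_in_window r01 (introT andP (conj d0 d1)).
pose s := sin del.
have s0 : 0 < s by apply: sin_gt0_pi; apply/andP; split; lra.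
pose eta := Num.min 2^-1 (s / 2).
have [e2 es] : eta <= 2^-1 /\ eta <= s / 2 by rewrite /eta !ge_min !lexx orbT.
have e0 : 0 < eta by rewrite /eta lt_min; apply/andP; split; lra.
have [n2 n20 h2] := jost_prod_rotation a_gt0 a_cvg b_cvg bounded_variation r01
  (ler0n _ 5) e0.
exists (maxn n1 n2); first by rewrite leq_max n10.
move=> n t t'; rewrite geq_max => /andP[n1n n2n] t0 tt tp ct ct' rt rt' hno.
have n0 : (0 < n)%N by rewrite (leq_trans n10).
have nR0 : 0 < n%:R :> R by rewrite ltr0n.
have ht : 0 <= t <= pi by rewrite t0 (le_trans (ltW tt)).
have ht' : 0 <= t' <= pi by rewrite tp (le_trans t0)// ltW.
set psi := n%:R * (t' - t).
have psi0 : 0 < psi by rewrite /psi mulr_gt0// subr_gt0.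
have psi1 : psi < pi + del.
  rewrite ltNge; apply/negP => psi1.
  have le1 : t + (pi + del) / n%:R <= t'.
    by rewrite addrC -lerBrDr ler_pdivrMr// mulrC.
  have le2 : t <= t + (pi + del) / n%:R.
    by rewrite lerDl divr_ge0//; lra.
  have [||v /andP[tv vt] rv] := h1 n t n1n t0 _ ct.
  - exact: le_trans le1 tp.
  - by apply: (abs_cos_between t0 tp _ ct ct'); rewrite le2.
  have hv : 0 <= v <= pi.
    by rewrite (le_trans t0 (ltW tv)) (le_trans (ltW vt))// (le_trans le1).
  have := hno (2 * cos v); rewrite rv !ltr_pM2l// !cos_ltE// tv (lt_le_trans vt)//.
  by move=> /(_ isT).
have xy : 2 * cos t' < 2 * cos t by rewrite ltr_pM2l// cos_ltE.
have opp : (p n.-1).[2 * cos t'] * (p n.-1).[2 * cos t] < 0.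
  case: n n0 rt rt' hno {n1n n2n nR0 psi psi0 psi1} => // n _ rt rt' hno /=.
  apply: (successive_roots_opposite xy rt' rt hno).
    have := wronskian_ge1 b a_gt0 n (2 * cos t'); rewrite (rootP rt') mul0r subr0.
    by move=> /(lt_le_trans ltr01); rewrite pmulr_rgt0// a_gt0.
  have := wronskian_ge1 b a_gt0 n (2 * cos t); rewrite (rootP rt) mul0r subr0.
  by move=> /(lt_le_trans ltr01); rewrite pmulr_rgt0// a_gt0.
have [|A A0] := h2 n t t' n2n ht ht' ct ct'.
  by rewrite ger0_norm ?subr_ge0 ?ltW// -/psi; lra_from psi1 d1 pi4.
rewrite -/psi /jost_prod /jost (rootP rt) (rootP rt').
set q := (p n.-1).[2 * cos t'] in opp *; set q' := (p n.-1).[2 * cos t] in opp *.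
rewrite (_ : _ * _ - _ = (q * q' - A * cos psi) -i* (A * sin psi)); last first.
  by apply/eqP; rewrite eq_complex/=; apply/andP; split; apply/eqP; ring.
move=> h; have := le_trans (abs_Re_le _) h; have := le_trans (abs_Im_le _) h.
rewrite /= normrN normrM [`|A|]ger0_norm ?(ltW A0)// [eta * A]mulrC ler_pM2l// => hs hc.
have {}hc : cos psi < eta.
  rewrite -(ltr_pM2l A0); move: hc; rewrite ler_norml => /andP[+ _]; lra_from opp.
have psi2 : pi / 2 < psi.
  rewrite ltNge; apply/negP => psi2.
  have c0 : 0 <= cos psi by apply: cos_ge0_pihalf; apply/andP; split; lra_from psi0 psi2 pi2.
  have := cos2Dsin2 psi; rewrite -[sin psi ^+ 2]real_normK ?num_real//.
  have : cos psi ^+ 2 <= eta ^+ 2 by rewrite lerXn2r// ?nnegrE// ltW.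
  have : `|sin psi| ^+ 2 <= eta ^+ 2 by rewrite lerXn2r// ?nnegrE// ltW.
  have : eta ^+ 2 <= (2^-1) ^+ 2 by rewrite lerXn2r// ?nnegrE// ltW.
  lra_from pi2.
rewrite ler_norml; apply/andP; split; last by lra_from psi1.
rewrite leNgt; apply/negP => psi3.
have : sin del < sin (pi - psi).
  by rewrite ltr_sin ?in_itv/=; [|apply/andP; split..]; lra_from psi0 psi1 psi2 psi3 d0 d1 pi2.
rewrite sinB sinpi cospi mul0r mulN1r sub0r opprK.
have := ler_norm (sin psi); rewrite -/s; lra_from hs es s0.
Qed.

End Zeros.

(** * The clock spacing *)

(** As [Num.sqrt] is 0 on nonpositive numbers and [0^-1 = 0], this vanishes outside
    the open interval from -2 to 2. *)
Definition arcsine_pdf (R : realType) (x : R) : R := (pi * Num.sqrt (4 - x ^+ 2))^-1.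

Section Clock.
Variables (R : realType) (a b : nat -> R).
Hypothesis a_gt0 : forall n : nat, (0 < n)%N -> 0 < a n.
Hypotheses (a_cvg : a n @[n --> \oo] --> (1 : R)) (b_cvg : b n @[n --> \oo] --> (0 : R)).
Hypothesis bounded_variation :
  (\sum_(1 <= n <oo) (`|a n.+1 - a n| + `|b n.+1 - b n|)%:E < +oo)%E.
Implicit Types (n N k : nat) (x y r t eta del eps : R).
Local Notation p n := (orthonormal_poly a b n).

Local Tactic Notation "lra_from" ne_hyp_list(hs) :=
  revert hs; clear - a_gt0 a_cvg b_cvg bounded_variation; intros; lra.

Lemma cos_chord t u : 0 <= t <= pi ->
  `| `|cos u - cos t| - sin t * `|u - t| | <= `|u - t| ^+ 2.
Proof.
move=> ht; have st := sin_ge0_pi ht.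
have [x xt ->] : exists2 x, `|x - t| <= `|u - t| & cos u - cos t = - sin x * (u - t).
  have cosc (v w : R) : {within `[v, w], continuous (@cos R)}.
    by apply: continuous_subspaceT => x; exact: continuous_cos.
  have [tu|ut] := leP t u.
    have [|c] := @MVT_segment _ cos (fun x => - sin x) _ _ tu; first exact: cosc.
    rewrite in_itv/= => /andP[tc cu] e; exists c => //.
    by rewrite !ger0_norm ?subr_ge0// lerB.
  have [|c] := @MVT_segment _ cos (fun x => - sin x) _ _ (ltW ut); first exact: cosc.
  rewrite in_itv/= => /andP[tc cu] e; exists c.
    by rewrite distrC (distrC u) !ger0_norm ?subr_ge0 ?(ltW ut)// lerB.
  by rewrite -opprB e -mulrN opprB.
rewrite normrM normrN -mulrBl normrM normr_id expr2 ler_wpM2r// (le_trans _ xt)//.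
rewrite -{1}[sin t]ger0_norm// (le_trans (ler_dist_dist _ _))//.
exact: sin_lip.
Qed.

(** In the angular variable the spacing tends to [pi / n]; the chord rule turns it
    into [2 * sin t * pi / n], and [2 * pi * sin t] is the reciprocal of the density. *)
Lemma clock_spacing eps eta : 0 < eps -> 0 < eta ->
  exists n0, forall n E E', (n0 <= n)%N ->
    successive_zeros (p n) (- 2 + eps) (2 - eps) E E' ->
    `| n%:R * `|E - E'| - (arcsine_pdf E)^-1 | <= eta.
Proof.
move=> eps0 eta0; have pi2 := @pi_ge2 R; have pi4 := @pi_lt4 R.
pose r := Num.max 0 (1 - eps / 2).
have r01 : 0 <= r < 1 by rewrite /r le_max lexx gt_max ltr01 /=; lra.
pose del := Num.min 2^-1 (eta / 4).
have [del1 del2] : del <= 2^-1 /\ del <= eta / 4 by rewrite /del !ge_min !lexx orbT.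
have d0 : 0 < del by rewrite /del lt_min; apply/andP; split; lra.
have d01 : 0 < del < 1 by apply/andP; split; lra.
have [n1 n10 h1] := successive_roots_angle a_gt0 a_cvg b_cvg bounded_variation r01 d01.
(* For [n >= 100 / eta] the second order error of [cos_chord], at most [5 ^ 2 / n], is at
   most [eta / 4]. *)
pose X := 100 / eta.
have X0 : 0 <= X by rewrite /X divr_ge0// ltW.
exists (maxn n1 (Num.bound X)) => n E E'; rewrite geq_max => /andP[n1n Xn].
have n0 : 0 < n%:R :> R by rewrite ltr0n (leq_trans n10).
have nX : 100 / eta <= n%:R.
  by rewrite (le_trans (ltW (archi_boundP X0)))// ler_nat.
rewrite ler_pdivrMr// in nX.
case; rewrite !in_itv/= => hE hE' rE rE' [EE' hno].
have angle x : - 2 + eps <= x <= 2 - eps -> exists t, [/\ 0 <= t <= pi,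
    `|cos t| <= r & x = 2 * cos t].
  move=> /andP[x1 x2]; have hx : -1 <= x / 2 <= 1.
    by apply/andP; split; lra_from x1 x2 eps0.
  exists (acos (x / 2)); have -> : cos (acos (x / 2)) = x / 2 by rewrite acosK// in_itv.
  split; [by rewrite acos_ge0 ?acos_lepi| |by field].
  by rewrite /r le_max; apply/orP; right; rewrite ler_norml; apply/andP; split; lra_from x1 x2.
have [t [ht ct tE]] := angle E hE.
have [t' [ht' ct' tE']] := angle E' hE'.
have psi : `|n%:R * `|t' - t| - pi| <= del.
  have /andP[t0 tp] := ht; have /andP[t0' tp'] := ht'.
  have [tt|tt|tt] := ltgtP t t'; last by rewrite tE tE' tt eqxx in EE'.
    rewrite [`|t' - t|]ger0_norm ?subr_ge0 ?(ltW tt)//; apply: h1; rewrite -?tE -?tE'//.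
    move=> x hx; apply/negP => rx; have /negP := hno x rx; apply.
    have hEE : E' < E by rewrite tE tE' ltr_pM2l// cos_ltE.
    by rewrite min_r ?max_l// ltW.
  rewrite [`|t' - t|]distrC [`|t - t'|]ger0_norm ?subr_ge0 ?(ltW tt)//; apply: h1; rewrite -?tE -?tE'//.
  move=> x hx; apply/negP => rx; have /negP := hno x rx; apply.
  have hEE : E < E' by rewrite tE tE' ltr_pM2l// cos_ltE.
  by rewrite min_l ?max_r// ltW.
have s0 := sin_ge0_pi ht; have s1 := sin_le1 t.
have -> : (arcsine_pdf E)^-1 = 2 * (sin t * pi).
  rewrite /arcsine_pdf invrK tE exprMn (_ : 4 - _ = 2 ^+ 2 * (1 - cos t ^+ 2)); last by ring.
  rewrite -sin2cos2 -exprMn sqrtr_sqr ger0_norm ?mulr_ge0//; ring.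
have -> : n%:R * `|E - E'| = 2 * (n%:R * `|cos t' - cos t|).
  by rewrite tE tE' -mulrBr normrM (ger0_norm (ler0n _ 2)) distrC; ring.
have := cos_chord t' ht; set c := `|cos t' - cos t|; set d := `|t' - t| in psi *.
have d_ge0 : 0 <= d by rewrite /d.
move=> hc.
have hd : n%:R * d <= 5 by move: psi; rewrite ler_norml => /andP[_]; lra_from del1 pi4.
have k1 : `|n%:R * c - n%:R * (sin t * d)| <= eta / 4.
  rewrite -mulrBr normrM normr_nat -(ler_pM2l n0).
  apply: (@le_trans _ _ (n%:R * (n%:R * d ^+ 2))).
    by rewrite ler_wpM2l ?(ltW n0)// ler_wpM2l ?(ltW n0).
  have : (n%:R * d) * (n%:R * d) <= 5 * 5 by rewrite ler_pM// mulr_ge0// ltW.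
  lra_from nX.
have k2 : `|n%:R * (sin t * d) - sin t * pi| <= eta / 4.
  rewrite mulrCA -mulrBr normrM (ger0_norm s0).
  rewrite (le_trans _ del2)// (le_trans _ psi)// ler_piMl//.
move: k1 k2; rewrite !ler_norml => /andP[k1 k2] /andP[k3 k4].
by apply/andP; split; lra_from k1 k2 k3 k4.
Qed.

Lemma clock_deviations_cvg eps : 0 < eps ->
  sup (clock_deviations a b (@arcsine_pdf R) (- 2 + eps) (2 - eps) n) @[n --> \oo]
    --> (0 : R).
Proof.
move=> eps0; apply/cvgrPdist_le => /= eta eta0.
have [n0 h] := clock_spacing eps0 eta0.
exists n0 => // n /= n0n; rewrite sub0r normrN.
set S := clock_deviations _ _ _ _ _ _.
have S_le d : S d -> d <= eta by move=> [E [E' [sz ->]]]; exact: h sz.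
have [[d Sd]|S0] := pselect (S !=set0); last first.
  by rewrite (_ : S = set0) ?sup0 ?normr0 ?ltW//; apply/eqP; apply: contra_notT S0 => /set0P.
have d0 : 0 <= d by case: Sd => E [E' [_ ->]].
have supS : has_sup S by split; [exists d|exists eta].
rewrite ger0_norm.
  by apply: ge_sup => //; exists d.
by rewrite (le_trans d0)//; apply: ub_le_sup => //; exists eta.
Qed.

End Clock.

(** * The arcsine law *)

Section Arcsine.
Variable R : realType.
Implicit Types (x t u : R).
Local Notation rho := (@arcsine_pdf R).
Local Notation mu := (@lebesgue_measure R).

Lemma arcsine_pdf_ge0 x : 0 <= rho x.
Proof. by rewrite invr_ge0 mulr_ge0 ?sqrtr_ge0// pi_ge0. Qed.

Lemma arcsine_pdf_out x : ~ (x \in `](-2 : R), 2[) -> rho x = 0.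
Proof.
move=> h; rewrite /arcsine_pdf ler0_sqrtr ?mulr0 ?invr0//.
have [h1|h1] := leP x (-2); first by nra.
have [h2|h2] := leP 2 x; first by nra.
by exfalso; apply: h; rewrite in_itv/= h1.
Qed.

Lemma four_sub_sqr_gt0 x : -2 < x < 2 -> 0 < 4 - x ^+ 2.
Proof. by move=> /andP[h1 h2]; nra. Qed.

Lemma arcsine_pdf_gt0 x : -2 < x < 2 -> 0 < rho x.
Proof.
by move=> /four_sub_sqr_gt0 h; rewrite invr_gt0 mulr_gt0 ?pi_gt0// sqrtr_gt0.
Qed.

Lemma arcsine_pdf_continuous x : -2 < x < 2 -> {for x, continuous rho}.
Proof.
move=> hx; apply: cvgV; first by rewrite -invr_eq0 gt_eqF// arcsine_pdf_gt0.
apply: cvgM; first exact: cvg_cst.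
apply: continuous_comp; last exact: sqrt_continuous.
by apply: cvgB; [exact: cvg_cst|exact: exprn_continuous].
Qed.

Lemma measurable_arcsine_pdf : measurable_fun setT rho.
Proof.
have -> : rho = rho \_ `](-2 : R), 2[.
  apply/funext => x; rewrite patchE; case: ifPn => //.
  by rewrite notin_setE/= => /arcsine_pdf_out.
apply/(measurable_restrictT _ _).1 => //.
apply: subspace_continuous_measurable_fun => //.
apply: continuous_in_subspaceT => x; rewrite inE/= in_itv/=.
exact: arcsine_pdf_continuous.
Qed.

Definition arcsine_prob : set (measurableTypeR R) -> \bar R :=
  fun A => (\int[mu]_(x in A) (rho x)%:E)%E.

Let measurable_EFin_pdf : measurable_fun setT (EFin \o rho).
Proof. by apply/measurable_EFinP; exact: measurable_arcsine_pdf. Qed.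

Let arcsine0 : arcsine_prob set0 = 0%E.
Proof. by rewrite /arcsine_prob integral_set0. Qed.

Let arcsine_ge0 A : (0 <= arcsine_prob A)%E.
Proof. by apply: integral_ge0 => x _; rewrite lee_fin arcsine_pdf_ge0. Qed.

Let arcsine_sigma_additive : semi_sigma_additive arcsine_prob.
Proof.
move=> /= F mF tF mUF; rewrite /arcsine_prob; apply: cvg_toP.
  apply: ereal_nondecreasing_is_cvgn => m n mn.
  apply: lee_sum_nneg_natr => // k _ _.
  by apply: integral_ge0 => x _; rewrite lee_fin arcsine_pdf_ge0.
rewrite ge0_integral_bigcup//=.
- exact: measurable_funTS.
- by move=> x _; rewrite lee_fin arcsine_pdf_ge0.
Qed.

HB.instance Definition _ := isMeasure.Build _ _ _ arcsine_prob
  arcsine0 arcsine_ge0 arcsine_sigma_additive.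

(** In the angular variable the arcsine law is uniform on [0, pi]: a primitive of its
    density is [x |-> - acos (x / 2) / pi]. *)
Lemma arcsine_prob_cos t u : 0 < t -> t < u -> u < pi ->
  arcsine_prob `]2 * cos u, 2 * cos t]%classic = ((u - t) / pi)%:E.
Proof.
move=> t0 tu up; have p0 := @pi_gt0 R.
have ht : 0 <= t <= pi by apply/andP; split; lra.
have hu : 0 <= u <= pi by apply/andP; split; lra.
have h0 : 0 <= (0 : R) <= pi by rewrite lexx pi_ge0.
have hp : 0 <= (pi : R) <= pi by rewrite lexx pi_ge0.
have c1 : cos u < cos t by rewrite cos_ltE.
have c2 : cos t < 1 by rewrite -cos0 cos_ltE.
have c3 : -1 < cos u by rewrite -cospi cos_ltE.
pose F x : R := - acos (x / 2) / pi.
have inner x : 2 * cos u <= x <= 2 * cos t -> -2 < x < 2.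
  by move=> /andP[h1 h2]; apply/andP; split; lra.
have dF x : -2 < x < 2 -> is_derive x 1 F (rho x).
  move=> hx; have hx2 : -1 < x / 2 < 1 by move: hx => /andP[h1 h2]; apply/andP; split; lra.
  have d1 := is_derive1_acos hx2.
  have d2 : is_derive x 1 (fun y : R => y / 2) (2^-1 : R).
    by apply: trigger_derive; rewrite /GRing.scale/= !mulr0 add0r mulr1.
  have d3 := @is_derive1_comp R acos (fun y => y / 2) x _ _ d1 d2.
  have d4 := @is_deriveZ _ _ _ (acos \o (fun y : R => y / 2)) (- pi^-1) x 1 _ d3.
  have FE : F = - pi^-1 \*: (acos \o (fun y : R => y / 2)).
    by apply/funext => y; rewrite /F; change (- acos (y / 2) / pi = - pi^-1 * acos (y / 2)); ring.
  rewrite FE; apply: (is_derive_eq d4).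
  have e : Num.sqrt (4 - x ^+ 2) = 2 * Num.sqrt (1 - (x / 2) ^+ 2).
    rewrite (_ : 4 - x ^+ 2 = 2 ^+ 2 * (1 - (x / 2) ^+ 2)); last by field.
    by rewrite sqrtrM ?sqr_ge0// sqrtr_sqr ger0_norm.
  have s1 := four_sub_sqr_gt0 hx.
  rewrite -sqrtr_gt0 e pmulr_rgt0// in s1.
  rewrite /arcsine_pdf e /GRing.scale/=.
  move: (Num.sqrt _) s1 (pi : R) p0 => s s1 q q0.
  by field; rewrite !gt_eqF.
have cF x : -2 < x < 2 -> {for x, continuous F}.
  move=> /dF[+ _] => /derivable1_diffP; exact: differentiable_continuous.
have mI (A : set R) : measurable_fun A (EFin \o rho) by exact: measurable_funTS.
rewrite /arcsine_prob (integral_itv_obnd_cbnd (mI _)).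
rewrite (@continuous_FTC2 _ rho F); first last.
- move=> x; rewrite in_itv/= => /andP[h1 h2]; rewrite derive1E.
  have hx : 2 * cos u <= x <= 2 * cos t by rewrite !ltW.
  by have [_ ->] := dF x (inner x hx).
- split.
  + move=> x; rewrite in_itv/= => /andP[h1 h2].
    have hx : 2 * cos u <= x <= 2 * cos t by rewrite !ltW.
    by have [] := dF x (inner x hx).
  + apply: cvg_at_right_filter; apply: cF; apply: inner; apply/andP; split; lra.
  + apply: cvg_at_left_filter; apply: cF; apply: inner; apply/andP; split; lra.
- apply: continuous_in_subspaceT => x; rewrite inE/= in_itv/= => /inner.
  exact: arcsine_pdf_continuous.
- by rewrite ltr_pM2l.
have K v : 0 <= v <= pi -> F (2 * cos v) = - v / pi.
  by move=> hv; rewrite /F (_ : 2 * cos v / 2 = cos v) ?cosK ?in_itv//; field.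
by rewrite !K// -EFinB; congr EFin; rewrite !mulNr opprK addrC -mulrBl.
Qed.

End Arcsine.

Section TotalMass.
Variable R : realType.
Implicit Types (x t u : R).
Local Notation rho := (@arcsine_pdf R).

Let e n : R := n.+2%:R^-1.
Let F n : set (measurableTypeR R) := `]2 * cos (pi - e n), 2 * cos (e n)]%classic.

Let e_gt0 n : 0 < e n. Proof. by rewrite invr_gt0 ltr0n. Qed.

Let e_le n : e n <= 2^-1.
Proof. by rewrite lef_pV2 ?posrE ?ltr0n// ler_nat. Qed.

Let F_mono : nondecreasing_seq F.
Proof.
move=> m n mn; apply/subsetPset => x; rewrite /F /= !in_itv/= => /andP[h1 h2].
have pi2 := @pi_ge2 R.
have emn : e n <= e m by rewrite lef_pV2 ?posrE ?ltr0n// ler_nat ltnS ltnS.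
have := e_gt0 n; have := e_gt0 m; have := e_le m; have := e_le n => a1 a2 a3 a4.
have r1 : 2 * cos (pi - e n) <= 2 * cos (pi - e m).
  by rewrite ler_pM2l// cos_leE; [lra|apply/andP; split; lra|apply/andP; split; lra].
have r2 : 2 * cos (e m) <= 2 * cos (e n).
  by rewrite ler_pM2l// cos_leE; [lra|apply/andP; split; lra|apply/andP; split; lra].
by rewrite (le_lt_trans r1 h1) (le_trans h2 r2).
Qed.

Let F_cover x : -2 < x < 2 -> exists n, F n x.
Proof.
move=> /andP[x1 x2]; have hx : -1 < x / 2 < 1 by apply/andP; split; lra.
have hx1 : -1 <= x / 2 <= 1 by apply/andP; split; lra.
have v0 : 0 < acos (x / 2) by rewrite acos_gt0//; apply/andP; split; lra.
have vp : acos (x / 2) < pi by rewrite acos_ltpi//; apply/andP; split; lra.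
have cv : cos (acos (x / 2)) = x / 2 by rewrite acosK// in_itv.
move: (acos (x / 2)) v0 vp cv => v v0 vp cv.
pose m := Num.min v (pi - v).
have m0 : 0 < m by rewrite lt_min v0 subr_gt0.
exists (Num.bound m^-1); have em : e (Num.bound m^-1) < m.
  rewrite -[ltRHS]invrK ltf_pV2 ?posrE ?invr_gt0 ?ltr0n//.
  rewrite (lt_le_trans (archi_boundP _)) ?invr_ge0 ?(ltW m0)// ler_nat.
  by rewrite (leq_trans _ (leqnSn _)).
have pi2 := @pi_ge2 R; have := e_le (Num.bound m^-1); have := e_gt0 (Num.bound m^-1).
move: em; rewrite /F /= in_itv/=; move: (e _) => d; rewrite lt_min => /andP[d1 d2] d3 d4.
have -> : x = 2 * cos v by rewrite cv; field.
rewrite ltr_pM2l// ler_pM2l// cos_ltE ?cos_leE; [|apply/andP; split; lra..].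
by apply/andP; split; lra.
Qed.

(** The density is unbounded at [-2] and [2], so the mass is computed as a limit over the
    arcs [e_n, pi - e_n]. *)
Lemma arcsine_prob_setT : arcsine_prob [set: measurableTypeR R] = 1%E.
Proof.
have pi2 := @pi_ge2 R; have p0 := @pi_gt0 R.
have mF n : measurable (F n) by exact: measurable_itv.
have mU : measurable (\bigcup_n F n) by exact: bigcup_measurable.
have -> : arcsine_prob setT = arcsine_prob (\bigcup_n F n).
  rewrite /arcsine_prob -[in RHS](setTI (\bigcup_n F n)) [RHS]integral_mkcondr/=.
  apply: eq_integral => x _; rewrite patchE; case: ifPn => //.
  rewrite notin_setE => h; rewrite arcsine_pdf_out// => hx; apply: h.
  by move: hx; rewrite in_itv/= => /F_cover[n Fn]; exists n.
have h1 := nondecreasing_cvg_mu (mu := @arcsine_prob R) mF mU F_mono.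
apply/esym; apply: (cvg_unique _ _ h1); first exact: ereal_hausdorff.
have -> : @arcsine_prob R \o F = fun n => (1 - 2 / pi * e n)%:E.
  apply/funext => n; have := e_gt0 n; have := e_le n => a1 a2.
  rewrite /= /F arcsine_prob_cos; [|lra..].
  congr EFin; move: (pi : R) p0 => q q0; field; rewrite ?gt_eqF//.
apply: cvg_EFin; first exact: nearW.
rewrite -[X in _ --> X]/(1 : R).
rewrite -[X in _ --> X](subr0 1) -(mulr0 (2 / pi)).
apply: cvgB; first exact: cvg_cst.
apply: cvgM; first exact: cvg_cst.
by have := @cvg_harmonic R; rewrite -(cvg_shiftS (@harmonic R)).
Qed.

HB.instance Definition _ := @Measure_isProbability.Build _ _ R
  (@arcsine_prob R) arcsine_prob_setT.

End TotalMass.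

(** * Weak convergence of the zero measures *)

Section Windows.
Variable R : realType.
Implicit Types (x t u h : R) (k m : nat).

Lemma arc_preimage x t u : 0 <= t -> u <= pi -> t <= u ->
  2 * cos u <= x <= 2 * cos t -> exists2 v, t <= v <= u & x = 2 * cos v.
Proof.
move=> t0 up tu /andP[ux xt].
have [->|nu] := eqVneq x (2 * cos u); first by exists u; rewrite ?lexx ?tu.
have [->|nt] := eqVneq x (2 * cos t); first by exists t; rewrite ?lexx ?tu.
have {}ux : 2 * cos u < x by rewrite lt_neqAle eq_sym nu.
have {}xt : x < 2 * cos t by rewrite lt_neqAle nt.
have ht : 0 <= t <= pi by rewrite t0 (le_trans tu).
have hu : 0 <= u <= pi by rewrite up andbT (le_trans t0).
have {}tu : t < u by rewrite -cos_ltE// -(ltr_pM2l (ltr0n R 2)) (lt_trans ux).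
have xI : 2 * cos u < x < 2 * cos t by rewrite ux xt.
have [v /andP[tv vu] xE] := two_cos_preimage t0 up tu xI.
by exists v => //; rewrite !ltW.
Qed.

(** An upper Darboux sum in the angular variable; outside the windows [g] is bounded by
    [M]. *)
Lemma arcsine_integral_windows (g : R -> R) (G : nat -> R) M th h m :
  continuous g -> (forall x, 0 <= g x <= M) -> 0 < th -> 0 < h ->
  th + m%:R * h < pi ->
  (forall k, (k < m)%N -> forall t, th + k%:R * h <= t <= th + k.+1%:R * h ->
     g (2 * cos t) <= G k) ->
  (\int[@arcsine_prob R]_x (g x)%:E <=
    (\sum_(k < m) G k * (h / pi) + M * (1 - m%:R * h / pi))%:E)%E.
Proof.
move=> cg gM th0 h0 thm hG; have p0 := @pi_gt0 R.
pose a k := th + k%:R * h.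
have a_mono i j : (i <= j)%N -> a i <= a j.
  by move=> ij; rewrite lerD2l ler_pM2r// ler_nat.
have a_gt0 k : 0 < a k by rewrite (lt_le_trans th0)// -[leLHS]addr0 lerD2l mulr_ge0// ltW.
have a_lt k : (k <= m)%N -> a k < pi by move=> /a_mono /le_lt_trans; apply.
pose I k : set (measurableTypeR R) := `]2 * cos (a k), 2 * cos th]%classic.
have mg (A : set (measurableTypeR R)) : measurable_fun A (EFin \o g).
  by apply: measurable_funTS; apply/measurable_EFinP; exact: continuous_measurable_fun.
have g0 x : (0%:E <= (EFin \o g) x)%E by rewrite lee_fin; have /andP[] := gM x.
have mI k : measurable (I k) by exact: measurable_itv.
have step k : (k <= m)%N ->
    (\int[@arcsine_prob R]_(x in I k) (g x)%:E <= (\sum_(j < k) G j * (h / pi))%:E)%E.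
  elim: k => [|k ih] km.
    rewrite big_ord0 /I /a mul0r addr0 set_itv_ge ?integral_set0//.
    by rewrite bnd_simp ltxx.
  pose W : set (measurableTypeR R) := `]2 * cos (a k.+1), 2 * cos (a k)]%classic.
  have mW : measurable W by exact: measurable_itv.
  have ak : a k < a k.+1 by rewrite ltrD2l ltr_pM2r// ltr_nat.
  have pk : a k.+1 < pi by exact: a_lt.
  have c1 : 2 * cos (a k.+1) <= 2 * cos (a k).
    by rewrite ler_pM2l// cos_leE; [exact: ltW|rewrite !ltW//; exact: lt_trans pk|rewrite !ltW].
  have c2 : 2 * cos (a k) <= 2 * cos th.
    have tha : th <= a k by rewrite -[th]addr0 -(mul0r h) -[0]/(0%:R) a_mono.
    have akp : a k < pi by rewrite (lt_trans ak).
    by rewrite ler_pM2l// cos_leE// ?(ltW th0) ?(le_trans tha) ?(ltW akp)// (ltW (a_gt0 k)).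
  have -> : I k.+1 = W `|` I k.
    apply/seteqP; split=> x; rewrite /I /W /= !in_itv/=.
      by move=> /andP[x1 x2]; have [xk|xk] := leP x (2 * cos (a k)); [left|right];
        rewrite ?x1 ?x2 ?xk.
    move=> [/andP[x1 x2]|/andP[x1 x2]].
      by rewrite x1 (le_trans x2).
    by rewrite (le_lt_trans c1).
  rewrite ge0_integral_setU//; first last.
  - rewrite disj_set2E; apply/eqP/seteqP; split=> x //=.
    rewrite /W /I /= !in_itv/= => -[/andP[_ x1] /andP[x2 _]].
    by move: (lt_le_trans x2 x1); rewrite ltxx.
  - by move=> x _; exact: g0.
  rewrite big_ord_recr/= addrC EFinD leeD//; last exact: ih (ltnW km).
  apply: (@le_trans _ _ (\int[@arcsine_prob R]_(x in W) (G k)%:E)%E).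
    apply: ge0_le_integral => //=.
    - by move=> x _; exact: g0.
    - move=> x; rewrite /W /= in_itv/= => /andP[/ltW x1 x2].
      have [||||v hv ->] := @arc_preimage x (a k) (a k.+1).
      - exact: ltW.
      - exact: ltW.
      - exact: ltW.
      - by rewrite x1.
      by rewrite lee_fin hG.
  rewrite integral_cst//= arcsine_prob_cos// -EFinM lee_fin.
  rewrite le_eqVlt; apply/predU1P; left; congr (_ * (_ / _)).
  by rewrite /a -natr1; ring.
have PI : arcsine_prob (I m) = (m%:R * h / pi)%:E.
  have [->|m0] := posnP m.
    rewrite /I /a !mul0r addr0 set_itv_ge ?measure0//.
    by rewrite bnd_simp ltxx.
  rewrite /I arcsine_prob_cos// /a; last by rewrite ltrDl mulr_gt0// ltr0n.
  by congr (_ / _)%:E; ring.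
rewrite -(setUv (I m)) ge0_integral_setU//; first last.
- by rewrite disj_set2E setICr.
- by move=> x _; exact: g0.
- exact: measurableC.
rewrite EFinD leeD ?step//.
apply: (@le_trans _ _ (\int[@arcsine_prob R]_(x in ~` (I m)) M%:E)%E).
  apply: ge0_le_integral => //=; first exact: measurableC.
    by move=> x _; exact: g0.
  by move=> x _; rewrite lee_fin; have /andP[] := gM x.
rewrite integral_cst//=; last exact: measurableC.
rewrite probability_setC// (_ : (1 - _)%E = (1 - m%:R * h / pi)%:E) -?EFinM//.
by rewrite EFinB; congr (_ - _)%E; exact: PI.
Qed.

End Windows.

Section ZeroMeasure.
Variables (R : realType) (a b : nat -> R).
Implicit Types (f : R -> R).
Local Notation p n := (orthonormal_poly a b n).

Definition zeros_mean f n : R := n%:R^-1 * \sum_(x <- rootsR (p n)) f x.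

Let ge0_integral_zero_measure f n : measurable_fun setT f -> (forall x, 0 <= f x) ->
  (\int[zero_measure a b n]_x (f x)%:E = (zeros_mean f n)%:E)%E.
Proof.
move=> mf f0; have mEf : measurable_fun [set: measurableTypeR R] (EFin \o f).
  exact/measurable_EFinP.
have f0E (x : measurableTypeR R) : setT x -> (0%:E <= (EFin \o f) x)%E by rewrite lee_fin.
rewrite /zero_measure ge0_integral_mscale//= ge0_integral_measure_sum//=.
under eq_bigr do rewrite integral_dirac// diracT mul1e.
rewrite sumEFin -EFinM; congr (_ * _)%:E.
by rewrite (big_nth 0) big_mkord.
Qed.

Lemma integral_zero_measure f n : continuous f ->
  (\int[zero_measure a b n]_x (f x)%:E = (zeros_mean f n)%:E)%E.
Proof.
move=> /continuous_measurable_fun mf.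
pose fp x := Num.max (f x) 0; pose fn x := Num.max (- f x) 0.
rewrite integralE.
have -> : (\int[zero_measure a b n]_x ((fun y => (f y)%:E)^\+ x) =
   \int[zero_measure a b n]_x (fp x)%:E)%E.
  by apply: eq_integral => x _; rewrite funeposE /fp EFin_max.
have -> : (\int[zero_measure a b n]_x ((fun y => (f y)%:E)^\- x) =
   \int[zero_measure a b n]_x (fn x)%:E)%E.
  by apply: eq_integral => x _; rewrite funenegE /fn EFin_max.
rewrite !ge0_integral_zero_measure.
- rewrite -EFinB; congr EFin; rewrite /zeros_mean -mulrBr; congr (_ * _).
  rewrite -sumrB; apply: eq_bigr => x _; rewrite /fp /fn.
  by case: (leP (f x) 0) => h; case: (leP (- f x) 0) => h'; lra.
- by apply: measurable_maxr => //; exact: measurable_funN.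
- by move=> x; rewrite /fn le_max lexx orbT.
- exact: measurable_maxr.
- by move=> x; rewrite /fp le_max lexx orbT.
Qed.

End ZeroMeasure.

Section ZeroCount.
Variables (R : realType) (a b : nat -> R).
Hypothesis a_gt0 : forall n : nat, (0 < n)%N -> 0 < a n.
Local Notation p n := (orthonormal_poly a b n).
Implicit Types (n : nat) (f : R -> R) (x : R).

Lemma size_orthonormal_poly n : (size (p n) <= n.+1)%N.
Proof.
suff : ((size (p n) <= n.+1) && (size (p n.+1) <= n.+2))%N by case/andP.
have mulX (c : R) (q : {poly R}) : (size (('X - c%:P) * q)%R <= (size q).+1)%N.
  by rewrite (leq_trans (size_polyMleq _ _))// size_XsubC.
elim: n => [|n /andP[ih1 ih2]].
  have -> : p 1%N = (a 1%N)^-1 *: (('X - (b 1%N)%:P) * 1 - a 0%N *: 0) by [].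
  rewrite [p 0%N]/= size_poly1 /= scaler0 subr0.
  by rewrite (leq_trans (size_scale_leq _ _))// (leq_trans (mulX _ _))// size_poly1.
rewrite ih2 andTb.
have -> : p n.+2 =
    (a n.+2)^-1 *: (('X - (b n.+2)%:P) * p n.+1 - a n.+1 *: p n) by [].
rewrite (leq_trans (size_scale_leq _ _))// (leq_trans (size_polyD _ _))//.
rewrite geq_max size_polyN (leq_trans (mulX _ _)) ?ltnS//=.
exact: leq_trans (size_scale_leq _ _) (leq_trans ih1 (leqW (leqnSn _))).
Qed.

Lemma orthonormal_poly_neq0 n : p n != 0.
Proof.
case: n => [|n]; first exact: oner_neq0.
apply/eqP => p0; have := wronskian_ge1 b a_gt0 n 0.
by rewrite p0 deriv0 !horner0 !mul0r subr0 mulr0 ler10.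
Qed.

Lemma mem_rootsR n x : (x \in rootsR (p n)) = root (p n) x.
Proof. by rewrite -(roots_on_rootsR (orthonormal_poly_neq0 n)). Qed.

Lemma size_rootsR n : (size (rootsR (p n)) <= n)%N.
Proof.
rewrite -ltnS (leq_trans _ (size_orthonormal_poly n))//.
apply: max_poly_roots; first exact: orthonormal_poly_neq0.
  by apply/allP => x; rewrite mem_rootsR.
exact: uniq_roots.
Qed.

Lemma zeros_mean_le f (M : R) n : (0 < n)%N -> 0 <= M -> (forall x, f x <= M) ->
  zeros_mean a b f n <= M.
Proof.
move=> n0 M0 fM; rewrite /zeros_mean mulrC ler_pdivrMr ?ltr0n//.
apply: (@le_trans _ _ (\sum_(x <- rootsR (p n)) M)); first exact: ler_sum.
by rewrite big_const_seq count_predT iter_addr_0 -[M *+ _]mulr_natr ler_wpM2l// ler_nat size_rootsR.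
Qed.

Lemma sum_roots_le f n (s : seq R) : uniq s -> {in s, forall x, root (p n) x} ->
  (forall x, 0 <= f x) -> \sum_(x <- s) f x <= \sum_(x <- rootsR (p n)) f x.
Proof.
move=> us hs f0; rewrite [leRHS](bigID (mem s))/=.
have -> : \sum_(x <- rootsR (p n) | x \in s) f x = \sum_(x <- s) f x.
  rewrite -big_filter; apply: perm_big.
  apply: uniq_perm => //; first by rewrite filter_uniq// uniq_roots.
  move=> x; rewrite mem_filter mem_rootsR /=.
  by case: (boolP (x \in s)) => // /hs ->.
by rewrite lerDl sumr_ge0.
Qed.

End ZeroCount.

Section Heine.
Variable R : realType.

(** Heine-Cantor, with only one of the two points confined to the segment. *)
Lemma continuous_segment_unif (f : R -> R) (u v eta : R) : continuous f -> 0 < eta ->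
  exists2 d, 0 < d & forall s t, u <= s <= v -> `|t - s| <= d -> `|f t - f s| <= eta.
Proof.
move=> cf e0; have e2 : 0 < eta / 2 by rewrite divr_gt0.
have /compact_near_coveringP := @segment_compact R u v.
move=> /(_ _ 0^'+ (fun d s => forall t, `|t - s| <= d -> `|f t - f s| <= eta)) [].
- move=> x _; have /cvgrPdist_le/(_ _ e2)/nbhs_ballP[r /= r0 hr] := cf x.
  have r2 : 0 < r / 2 by rewrite divr_gt0.
  exists (ball x (r / 2), [set d | d < r / 2]) => /=.
    split; first exact: nbhsx_ballx.
    exact: nbhs_right_lt.
  move=> [s d] /= [xs dr] t td.
  have h1 := hr s; have h2 := hr t.
  have xs2 : `|x - s| < r / 2 by [].
  have {}h1 : `|f x - f s| <= eta / 2 by apply: h1; rewrite /ball/=; lra.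
  have {}h2 : `|f x - f t| <= eta / 2.
    apply: h2; rewrite /ball/= -[x](subrK s) -addrA (le_lt_trans (ler_normD _ _))//.
    by rewrite (distrC s); lra.
  have -> : f t - f s = (f x - f s) - (f x - f t) by ring.
  by rewrite (le_trans (ler_normB _ _))//; lra.
move=> e /= e0' he; exists (e / 2); first by rewrite divr_gt0.
move=> s t hs; apply: (he (e / 2)).
- by rewrite /ball/= sub0r normrN ger0_norm ?divr_ge0 ?ltW// ltr_pdivrMr//; lra.
- by rewrite divr_gt0.
- by rewrite /= in_itv.
Qed.

End Heine.

Section DensityOfStates.
Variables (R : realType) (a b : nat -> R).
Hypothesis a_gt0 : forall n : nat, (0 < n)%N -> 0 < a n.
Hypotheses (a_cvg : a n @[n --> \oo] --> (1 : R)) (b_cvg : b n @[n --> \oo] --> (0 : R)).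
Hypothesis bounded_variation :
  (\sum_(1 <= n <oo) (`|a n.+1 - a n| + `|b n.+1 - b n|)%:E < +oo)%E.
Local Notation p n := (orthonormal_poly a b n).
Implicit Types (n : nat) (g f : R -> R) (M eps : R).

Local Tactic Notation "lra_from" ne_hyp_list(hs) :=
  revert hs; clear - a_gt0 a_cvg b_cvg bounded_variation; intros; lra.

(** Every window of [root_in_window] has arcsine mass about [1 / n] and contains a
    root, so the zeros carry, up to a small error, at least the mass of the limit law. *)
Lemma arcsine_integral_le_zeros_mean g M eps :
  continuous g -> 0 < M -> (forall x, 0 <= g x <= M) -> 0 < eps ->
  exists n0, forall n, (n0 <= n)%N ->
    (\int[@arcsine_prob R]_x (g x)%:E <= (zeros_mean a b g n + eps)%:E)%E.
Proof.
move=> cg M0 gM eps0; have pi2 := @pi_ge2 R; have pi4 := @pi_lt4 R.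
have p0 := @pi_gt0 R; have g0 x : 0 <= g x by have /andP[] := gM x.
have e4 : 0 < eps / 4 by rewrite divr_gt0.
have cgc : continuous (fun t : R => g (2 * cos t)).
  move=> t; apply: continuous_comp; last exact: cg.
  by apply: cvgM; [exact: cvg_cst|exact: continuous_cos].
have [d d0 hd] := continuous_segment_unif 0 pi cgc e4.
have eM : 0 < eps / (4 * M) by rewrite divr_gt0// mulr_gt0.
have eME : M * (eps / (4 * M)) = eps / 4 by field; rewrite gt_eqF.
move: (eps / (4 * M)) eM eME => q q0 qE.
pose th := Num.min 4^-1 q.
have [th1 th2] : th <= 4^-1 /\ th <= q by rewrite /th !ge_min !lexx orbT.
have th0 : 0 < th by rewrite /th lt_min q0 andbT; lra.
pose del := Num.min 2^-1 q.
have [del1 del2] : del <= 2^-1 /\ del <= q by rewrite /del !ge_min !lexx orbT.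
have del0 : 0 < del by rewrite /del lt_min q0 andbT; lra.
have hth : 0 <= th <= pi by apply/andP; split; lra.
have r01 : 0 <= cos th < 1.
  apply/andP; split; first by apply: cos_ge0_pihalf; apply/andP; split; lra.
  by rewrite -cos0 cos_ltE// lexx pi_ge0.
have d01 : 0 < del < 1 by apply/andP; split; lra.
have [n1 n10 h1] := root_in_window a_gt0 a_cvg b_cvg bounded_variation r01 d01.
pose X := Num.max (5 / d) (Num.max (5 / q) 20).
have X0 : 0 <= X by rewrite /X !le_max; apply/orP; right; apply/orP; right; lra.
exists (maxn n1 (Num.bound X)) => n; rewrite geq_max => /andP[n1n Xn].
have n_gt0 : (0 < n)%N by rewrite (leq_trans n10).
have nR : 0 < n%:R :> R by rewrite ltr0n.
have {Xn} : X <= n%:R by rewrite (le_trans (ltW (archi_boundP X0)))// ler_nat.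
rewrite /X !ge_max => /and3P[nd nq n20].
pose h := (pi + del) / n%:R.
have h_gt0 : 0 < h by rewrite divr_gt0//; lra_from p0 del0.
have h5 c : 0 < c -> 5 / c <= n%:R -> h <= c.
  move=> c0; rewrite ler_pdivrMr// => hc; rewrite /h ler_pdivrMr//; lra_from hc pi4 del1.
have hd' : h <= d by exact: h5.
have hq : h <= q by exact: h5.
have h4 : h <= 4^-1 by apply: h5; lra_from n20.
pose Y := (pi - 2 * th) / h.
have Y0 : 0 <= Y by rewrite divr_ge0 ?(ltW h_gt0)//; lra_from pi2 th1.
pose m := Num.truncn Y.
have /andP[m1 m2] := truncn_itv Y0; rewrite -/m in m1 m2.
have {}m1 : m%:R * h <= pi - 2 * th by rewrite -ler_pdivlMr.
have {}m2 : pi - 2 * th < m%:R * h + h.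
  have -> : m%:R * h + h = m.+1%:R * h by rewrite -natr1; ring.
  by rewrite -ltr_pdivrMr.
pose tk k : R := th + k%:R * h.
have tk_le i j : (i <= j)%N -> tk i <= tk j by move=> ij; rewrite lerD2l ler_pM2r// ler_nat.
have tkS k : tk k.+1 = tk k + h by rewrite /tk -natr1; ring.
have th_tk k : th <= tk k by rewrite lerDl mulr_ge0// ltW.
have tk_pi k : (k <= m)%N -> tk k <= pi - th.
  by move=> /tk_le h2; rewrite (le_trans h2)// /tk; lra_from m1.
have cth : `|cos th| <= cos th by rewrite ger0_norm//; case/andP: r01.
have ctk k : (k <= m)%N -> `|cos (tk k)| <= cos th.
  move=> km; apply: (@abs_cos_between _ th _ (pi - th)) => //.
  - exact: ltW.
  - by rewrite gerBl ltW.
  - by rewrite th_tk tk_pi.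
  by rewrite cosB cospi sinpi mulN1r mul0r addr0 normrN.
have [v hv] : exists v : nat -> R, forall k, (k < m)%N ->
    tk k < v k < tk k.+1 /\ root (p n) (2 * cos (v k)).
  have ex k : exists x, (k < m)%N -> tk k < x < tk k.+1 /\ root (p n) (2 * cos x).
    have [km|km] := ltnP k m; last by exists 0.
    have t0 : 0 <= tk k by rewrite (le_trans (ltW th0)).
    have [|||x hx rx] := h1 n (tk k) n1n t0; rewrite -/h -?tkS.
    - by rewrite (le_trans (tk_pi _ km))// gerBl ltW.
    - exact: ctk (ltnW km).
    - exact: ctk.
    by exists x => _; rewrite tkS.
  by have [v hv] := choice ex; exists v.
pose eta := eps / 4.
have v_lt i j : (i < j < m)%N -> v i < v j.
  move=> /andP[ij jm]; have [/andP[_ h2] _] := hv i (ltn_trans ij jm).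
  have [/andP[h3 _] _] := hv j jm.
  by rewrite (lt_trans h2)// (le_lt_trans _ h3)// tk_le.
have v_rng k : (k < m)%N -> 0 <= v k <= pi.
  move=> km; have [/andP[h2 h3] _] := hv k km; have h6 := tk_pi _ km; have h7 := th_tk k.
  by apply/andP; split; lra_from th0 h2 h3 h6 h7.
have us : uniq [seq 2 * cos (v k) | k <- iota 0 m].
  rewrite map_inj_in_uniq ?iota_uniq// => i j; rewrite !mem_iota !add0n /= => im jm e.
  have ltcos i' j' : (i' < j' < m)%N -> 2 * cos (v j') < 2 * cos (v i').
    move=> /[dup] ij /andP[i'j j'm]; rewrite ltr_pM2l// cos_ltE ?v_rng ?v_lt//.
    exact: ltn_trans j'm.
  have [ij|ij|//] := ltngtP i j.
    by have := ltcos i j; rewrite ij jm e ltxx => /(_ isT).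
  by have := ltcos j i; rewrite ij im e ltxx => /(_ isT).
have rs : {in [seq 2 * cos (v k) | k <- iota 0 m], forall x, root (p n) x}.
  by move=> x /mapP[k]; rewrite mem_iota add0n => /= /hv[_ rk] ->.
have := sum_roots_le a_gt0 us rs g0; rewrite big_map => sum_le.
have thm : th + m%:R * h < pi by lra_from m1 th0.
have hG k : (k < m)%N -> forall t, th + k%:R * h <= t <= th + k.+1%:R * h ->
    g (2 * cos t) <= g (2 * cos (v k)) + eta.
  move=> km t; rewrite -!/(tk _) => /andP[t1 t2].
  have [/andP[v1 v2] _] := hv k km; rewrite tkS in t2 v2.
  have tv : `|t - v k| <= d by rewrite ler_norml; apply/andP; split; lra_from t1 t2 v1 v2 hd'.
  by have := hd _ _ (v_rng k km) tv; rewrite ler_norml -/eta => /andP[_]; lra_from e4.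
apply: (le_trans (arcsine_integral_windows cg gM th0 h_gt0 thm hG)).
rewrite lee_fin -mulr_suml big_split/= sumr_const card_ord.
have -> : \sum_(k < m) g (2 * cos (v k)) = \sum_(k <- iota 0 m) g (2 * cos (v k)).
  by rewrite -(big_mkord xpredT (fun k => g (2 * cos (v k)))) /index_iota subn0.
set S := \sum_(k <- iota 0 m) _ in sum_le *.
have JM : zeros_mean a b g n <= M.
  by apply: zeros_mean_le => //; [exact: ltW|move=> x; have /andP[] := gM x].
set J := zeros_mean a b g n in JM *.
have SJ : S / n%:R <= J by rewrite /J /zeros_mean mulrC ler_pM2l// invr_gt0.
have S0 : 0 <= S / n%:R by rewrite divr_ge0// sumr_ge0.
rewrite -[eta *+ m]mulr_natr.
have -> : (S + eta * m%:R) * (h / pi) =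
   S / n%:R + (S / n%:R) * del / pi + eta * (m%:R * h / pi).
  rewrite /h; move: (pi : R) p0 => P P0; field; rewrite !gt_eqF//.
have ip : pi^-1 <= 2^-1 :> R by rewrite lef_pV2 ?posrE.
have ip0 : 0 < pi^-1 :> R by rewrite invr_gt0.
have pE : pi * pi^-1 = 1 :> R by rewrite mulfV// gt_eqF.
have [w wE] : {w : R | w = pi^-1} by exists pi^-1.
rewrite -wE in ip ip0 pE *.
have mh0 : 0 <= m%:R * h by rewrite mulr_ge0// ltW.
have k0 : m%:R * h <= pi by rewrite (le_trans m1)// gerBl mulr_ge0// ltW.
have k1 : m%:R * h * w <= 1 by have := ler_wpM2r (ltW ip0) k0; rewrite pE.
have k2 : eta * (m%:R * h * w) <= eta by apply: ler_piMr => //; exact: ltW.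
have k3 : 1 - m%:R * h * w <= (2 * th + h) * 2^-1.
  rewrite -[X in X - _]pE -mulrBl; apply: (@le_trans _ _ ((2 * th + h) * w)).
    by rewrite ler_wpM2r ?(ltW ip0)//; lra_from m2.
  by rewrite ler_wpM2l//; lra_from th0 h_gt0.
have k4 : M * (1 - m%:R * h * w) <= M * (q + q / 2).
  by rewrite ler_wpM2l ?(ltW M0)// (le_trans k3)//; lra_from th2 hq.
have k5 : S / n%:R * del * w <= M * q * 2^-1.
  apply: ler_pM => //; [by apply: mulr_ge0 => //; exact: ltW|exact: ltW|].
  by apply: ler_pM => //; [exact: ltW|exact: le_trans JM].
(* Of the loss, [eps / 8] pays for windows longer than [pi / n], [eps / 4] for the oscillation
   of [g] on a window, and [3 * eps / 8] for the arcs outside all windows. *)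
rewrite /eta in k2 *; lra_from k2 k4 k5 SJ qE eps0.
Qed.

End DensityOfStates.

Section WeakLimit.
Variables (R : realType) (a b : nat -> R).
Hypothesis a_gt0 : forall n : nat, (0 < n)%N -> 0 < a n.
Hypotheses (a_cvg : a n @[n --> \oo] --> (1 : R)) (b_cvg : b n @[n --> \oo] --> (0 : R)).
Hypothesis bounded_variation :
  (\sum_(1 <= n <oo) (`|a n.+1 - a n| + `|b n.+1 - b n|)%:E < +oo)%E.
Implicit Types (n : nat) (f : R -> R) (M eps : R).

Lemma integrable_arcsine f M : continuous f -> (forall x, `|f x| <= M) ->
  (@arcsine_prob R).-integrable setT (EFin \o f).
Proof.
move=> cf fM; apply: measurable_bounded_integrable => //.
- by rewrite (_ : _ [set: _] = 1%E) ?ltry//; exact: arcsine_prob_setT.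
- exact: continuous_measurable_fun.
by exists M; split; [exact: num_real|move=> x Mx y _ /=; rewrite (le_trans (fM y))// ltW].
Qed.

(** Adding [M] makes [f] nonnegative; as the zeros have total mass at most 1, it adds at
    most [M] on the side of the zeros, and exactly [M] on the side of the limit. *)
Lemma arcsine_integral_le_limit f M eps : continuous f -> 0 < M ->
  (forall x, `|f x| <= M) -> 0 < eps ->
  exists n0, forall n, (n0 <= n)%N ->
    fine (\int[@arcsine_prob R]_x (f x)%:E)%E <= zeros_mean a b f n + eps.
Proof.
move=> cf M0 fM eps0; pose g x := f x + M.
have cg : continuous g by move=> x; apply: cvgD; [exact: cf|exact: cvg_cst].
have gM x : 0 <= g x <= 2 * M.
  by have := fM x; rewrite ler_norml /g => /andP[h1 h2]; apply/andP; split; lra.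
have M2 : 0 < 2 * M by rewrite mulr_gt0.
have [n1 h1] := arcsine_integral_le_zeros_mean a_gt0 a_cvg b_cvg bounded_variation cg M2 gM eps0.
exists (maxn n1 1) => n; rewrite geq_max => /andP[/h1 {}h1 n0].
have if_ := integrable_arcsine cf fM.
have iM : (@arcsine_prob R).-integrable setT (EFin \o cst M).
  by apply: (@integrable_arcsine _ `|M|) => x; [exact: cvg_cst|].
have gE : (\int[@arcsine_prob R]_x (g x)%:E =
    (fine (\int[@arcsine_prob R]_x (f x)%:E) + M)%:E)%E.
  rewrite (_ : (fun x => (g x)%:E) = (EFin \o f) \+ (EFin \o cst M))%E//.
  rewrite integralD// EFinD fineK ?integrable_fin_num//; congr (_ + _)%E.
  rewrite -[RHS]mule1 -(arcsine_prob_setT R). exact: (integral_cst (@arcsine_prob R) (@measurableT _ _) M%:E).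
move: h1; rewrite gE lee_fin => h1.
have le1 : zeros_mean a b g n <= zeros_mean a b f n + M.
  rewrite /zeros_mean /g big_split/= mulrDr lerD2l.
  by apply: (@zeros_mean_le _ _ _ a_gt0 (cst M)) => //; exact: ltW.
lra.
Qed.

(** The one-sided bound for [f] and for [- f]. *)
Lemma arcsine_density_of_states : is_density_of_states a b (@arcsine_prob R).
Proof.
move=> f cf [M0 [_ hM0]].
have [M M_gt0 fM] : exists2 M, 0 < M & forall x, `|f x| <= M.
  exists (`|M0| + 1) => [|x]; first by rewrite ltr_wpDl.
  by apply: hM0 => //; rewrite ltr_pwDr// ler_norm.
have -> : (fun n => \int[zero_measure a b n]_x (f x)%:E)%E = (fun n => (zeros_mean a b f n)%:E).
  by apply/funext => n; rewrite integral_zero_measure.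
have iE : (\int[@arcsine_prob R]_x (f x)%:E)%E =
    (fine (\int[@arcsine_prob R]_x (f x)%:E)%E)%:E.
  by rewrite fineK// integrable_fin_num//; exact: integrable_arcsine fM.
rewrite iE; apply: cvg_EFin; first exact: nearW.
apply/cvgrPdist_le => /= eps eps0.
have [n1 h1] := arcsine_integral_le_limit cf M_gt0 fM eps0.
have cNf : continuous (fun x => - f x) by move=> x; apply: cvgN; exact: cf.
have NfM x : `| - f x| <= M by rewrite normrN.
have [n2 h2] := arcsine_integral_le_limit cNf M_gt0 NfM eps0.
exists (maxn n1 n2) => // n /=; rewrite geq_max => /andP[/h1 {}h1 /h2].
have -> : (\int[@arcsine_prob R]_x (- f x)%:E = - \int[@arcsine_prob R]_x (f x)%:E)%E.
  have if_ := integrable_arcsine cf fM.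
  rewrite -(@integralN _ _ _ (@arcsine_prob R) setT (EFin \o f))//; exact: integrable_add_def if_.
rewrite fineN (_ : zeros_mean a b (fun x => - f x) n = - zeros_mean a b f n).
  by move: h1 => h1 h2'; rewrite ler_norml; apply/andP; split; lra.
by rewrite /zeros_mean sumrN mulrN.
Qed.

End WeakLimit.

Theorem theorem1p4 (R : realType) (a b : nat -> R)
  (hJ : jacobi_parameters a b)
  (ha : a n @[n --> \oo] --> (1 : R))
  (hb : b n @[n --> \oo] --> (0 : R))
  (hvar : (\sum_(1 <= n <oo) (`|a n.+1 - a n| + `|b n.+1 - b n|)%:E < +oo)%E)
  (eps : R) (heps : 0 < eps) :
  uniform_clock_behavior a b (- 2 + eps) (2 - eps).
Proof.
case: hJ => a_gt0 _.
have inside x : x \in `[(- 2 + eps), (2 - eps)] -> -2 < x < 2.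
  by rewrite in_itv/= => /andP[x1 x2]; apply/andP; split; lra.
exists (@arcsine_prob R), (@arcsine_pdf R); split.
- exact: arcsine_density_of_states.
- by [].
- apply: continuous_in_subspaceT => x; rewrite inE => /inside.
  exact: arcsine_pdf_continuous.
- by move=> x /inside /arcsine_pdf_gt0/lt0r_neq0.
- exact: clock_deviations_cvg.
Qed.
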